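(* For all $m\le n/2$ and every positive integer $t$ there exists a constant $c_{m,n}(2t)$ such that: (1) for every finite nonempty $\mathcal{D}\subset\mathcal{G}_{m,n}$, $\frac{1}{|\mathcal{D}|^2}\sum_{p,p'\in\mathcal{D}}\sigma(p,p')^t\ge c_{m,n}(2t)$; (2) $\mathcal{D}$ is a $2t$-design if and only if $\frac{1}{|\mathcal{D}|^2}\sum_{p,p'\in\mathcal{D}}\sigma(p,p')^t=c_{m,n}(2t)$.
   Context: $\mathcal{G}_{m,n}$ is the Grassmannian of $m$-dimensional subspaces of $\mathbb{R}^n$ ($m\le n/2$) with its $O(\mathbb{R}^n)$-action and invariant probability measure; $L^2(\mathcal{G}_{m,n})=\bigoplus_\mu H^{2\mu}_{m,n}$ over partitions $\mu=(\mu_1\ge\dots\ge\mu_m\ge0)$, with $H^{2\mu}_{m,n}$ the multiplicity-one component isomorphic to the irreducible $O(\mathbb{R}^n)$-representation associated with the partition $2\mu$; $\deg\mu=\sum\mu_i$. A finite $\mathcal{D}\subset\mathcal{G}_{m,n}$ is a $2t$-design if $\sum_{x\in\mathcal{D}}f(x)=0$ for every $f\in H^{2\mu}_{m,n}$ with $1\le\deg\mu\le t$. For $p,p'\in\mathcal{G}_{m,n}$ with principal angles $\theta_1,\dots,\theta_m$, $y_i=\cos^2\theta_i$ and $\sigma(p,p')=y_1+\dots+y_m$ (equivalently the trace of the product of the orthogonal projections onto $p$ and $p'$). *)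

(* Defs.v *)
From HB Require Import structures.
From mathcomp Require Import all_boot all_order all_algebra all_fingroup finmap.
From mathcomp Require Import all_classical all_reals all_analysis.

Set Implicit Arguments.
Unset Strict Implicit.
Unset Printing Implicit Defensive.

Import Order.TTheory GRing.Theory Num.Theory.
Import numFieldNormedType.Exports.

Local Open Scope ring_scope.

Section OrthogonalGroup.
Variables (R : realType) (n : nat).

Record orthogonal := Orthogonal {
  orth_mx :> 'M[R]_n;
  orth_mxP : orth_mx *m orth_mx^T = 1%:M }.

(* Vectors are rows, so [g] sends the row of coordinates [v] to [v *m g^T]. *)
Definition rot (g : 'M[R]_n) : 'End('rV[R]_n) := linfun (mulmxr g^T).

Lemma rotE g v : rot g v = v *m g^T.
Proof. by rewrite lfunE. Qed.

Lemma rot_inj (g : orthogonal) : lker (rot g) == 0%VS.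
Proof.
apply/lker0P => u v; rewrite !rotE => guv.
have gg : g^T *m g = 1%:M by apply: mulmx1C; exact: orth_mxP.
by rewrite -[u]mulmx1 -[v]mulmx1 -gg !mulmxA guv.
Qed.

End OrthogonalGroup.

Section Grassmannian.
Variables (R : realType) (m n : nat).

Record grassmannian := Grassmannian {
  gspace :> {vspace 'rV[R]_n};
  gspace_dim : \dim gspace == m }.

HB.instance Definition _ := [isSub for gspace].
HB.instance Definition _ := [Choice of grassmannian by <:].

Lemma rot_dim (g : orthogonal R n) (p : grassmannian) :
  \dim (rot g @: p)%VS == m.
Proof.
by rewrite limg_dim_eq ?(eqP (rot_inj g)) ?capv0 // gspace_dim.
Qed.

Definition gact (g : orthogonal R n) (p : grassmannian) : grassmannian :=
  Grassmannian (rot_dim g p).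

End Grassmannian.

Section Projection.
Variables (R : realType) (n : nat).
Implicit Type U : {vspace 'rV[R]_n}.

Definition basis_mx U : 'M[R]_(\dim U, n) := \matrix_i (vbasis U)`_i.

(* [B^T (B B^T)^-1 B], where the rows of [B] form a basis of [U]. *)
Definition orth_proj U : 'M[R]_n :=
  let B := basis_mx U in B^T *m invmx (B *m B^T) *m B.

Lemma basis_mx_mul U (c : 'rV[R]_(\dim U)) :
  c *m basis_mx U = \sum_i c 0 i *: (vbasis U)`_i.
Proof. by rewrite mulmx_sum_row; apply: eq_bigr => i _; rewrite rowK. Qed.

Lemma basis_mx_inj U (c : 'rV[R]_(\dim U)) : c *m basis_mx U = 0 -> c = 0.
Proof.
rewrite basis_mx_mul => c0; apply/rowP => i; rewrite mxE.
have /freeP fr := basis_free (vbasisP U).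
exact: (fr (fun i => c 0 i) c0 i).
Qed.

Lemma mem_basis_mx U v : reflect (exists c, v = c *m basis_mx U) (v \in U).
Proof.
apply: (iffP idP) => [vU|[c ->]].
  exists (\row_i coord (vbasis U) i v).
  rewrite basis_mx_mul {1}(coord_vbasis vU).
  by apply: eq_bigr => i _; rewrite mxE.
rewrite basis_mx_mul; apply: rpred_sum => i _; apply: rpredZ.
by apply: vbasis_mem; apply: mem_nth; rewrite size_tuple.
Qed.

Lemma row_norm0 k (v : 'rV[R]_k) : v *m v^T = 0 -> v = 0.
Proof.
move=> /matrixP /(_ 0 0); rewrite !mxE => vv.
apply/rowP => i; rewrite mxE.
have : \sum_j v 0 j ^+ 2 == 0.
  by rewrite -[X in _ == X]vv; apply/eqP/eq_bigr => j _; rewrite mxE expr2.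
rewrite psumr_eq0 => [/allP /(_ i)|j _]; last exact: sqr_ge0.
by rewrite mem_index_enum sqrf_eq0 => /(_ isT) /eqP.
Qed.

Lemma gram_unit U : basis_mx U *m (basis_mx U)^T \in unitmx.
Proof.
rewrite -row_free_unit -kermx_eq0; apply/eqP/row_matrixP => i; rewrite row0.
apply: basis_mx_inj; apply: row_norm0; rewrite trmx_mul mulmxA -[X in X *m _]mulmxA.
by rewrite -row_mul mulmx_ker row0 mul0mx.
Qed.

Lemma orth_proj_sym U : (orth_proj U)^T = orth_proj U.
Proof. by rewrite /orth_proj !trmx_mul trmx_inv trmx_mul !trmxK mulmxA. Qed.

Lemma orth_proj_fix U v : v \in U -> v *m orth_proj U = v.
Proof.
move=> /mem_basis_mx [c ->].
rewrite /orth_proj -!mulmxA (mulmxA (basis_mx U)) (mulmxA (basis_mx U *m _)).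
by rewrite mulmxV ?gram_unit // mul1mx.
Qed.

Lemma orth_proj_mem U v : v *m orth_proj U \in U.
Proof. by apply/mem_basis_mx; rewrite /orth_proj mulmxA; eexists. Qed.

End Projection.

(* The Grassmannian carries the topology of its embedding in matrices. *)
HB.instance Definition _ (R : realType) (m n : nat) :=
  Topological.copy (grassmannian R m n)
    (initial_topology (fun p : grassmannian R m n => orth_proj p)).

Section Sigma.
Variables (R : realType) (m n : nat).
Implicit Types p q : grassmannian R m n.

Definition sigma p q : R := \tr (orth_proj p *m orth_proj q).

Lemma orth_projE (U : {vspace 'rV[R]_n}) (A : 'M[R]_(m, n)) :
  A *m A^T = 1%:M -> (forall v, reflect (exists c, v = c *m A) (v \in U)) ->
  orth_proj U = A^T *m A.
Proof.
move=> AA UA.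
have AP : A *m orth_proj U = A.
  apply/row_matrixP => i; rewrite row_mul orth_proj_fix //.
  by apply/UA; exists (delta_mx 0 i); rewrite rowE.
have PA : orth_proj U *m A^T *m A = orth_proj U.
  apply/row_matrixP => i; rewrite (row_mul i _ A) (row_mul i _ A^T).
  have : row i (orth_proj U) \in U by rewrite rowE orth_proj_mem.
  by move=> /UA [c ->]; rewrite -(mulmxA c) AA mulmx1.
by rewrite -PA -{1}orth_proj_sym -trmx_mul AP.
Qed.

(* The principal angles of [p] and [q] are the [theta i] in [[0, pi/2]] for
   which there are orthonormal bases (the rows of [A] and [B]) of [p] and [q]
   with Gram matrix [diag (cos (theta i))]. *)
Lemma sigma_principal_angles p q (A B : 'M[R]_(m, n)) (theta : 'I_m -> R) :
  A *m A^T = 1%:M -> (forall v, reflect (exists c, v = c *m A) (v \in gspace p)) ->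
  B *m B^T = 1%:M -> (forall v, reflect (exists c, v = c *m B) (v \in gspace q)) ->
  A *m B^T = diag_mx (\row_i cos (theta i)) ->
  sigma p q = \sum_i cos (theta i) ^+ 2.
Proof.
move=> AA pA BB qB AB.
rewrite /sigma (orth_projE AA pA) (orth_projE BB qB).
rewrite -mulmxA mxtrace_mulC !mulmxA AB -mulmxA.
rewrite -[B *m _]trmxK trmx_mul trmxK AB tr_diag_mx mulmx_diag mxtrace_diag.
by apply: eq_bigr => i _; rewrite !mxE expr2.
Qed.

End Sigma.

(* Weyl's construction of the irreducible O(n)-module attached to a partition
   [lam] with at most [n / 2] parts. *)
Section WeylModule.
Variables (R : realType) (m n : nat) (lam : 'I_m -> nat).

(* Boxes of the Young diagram; they index the tensor factors, so the diagram
   is its own tableau. *)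
Definition box : Type := {i : 'I_m & 'I_(lam i)}.
HB.instance Definition _ := Finite.on box.

Definition box_row (b : box) : 'I_m := tag b.
Definition box_col (b : box) : nat := tagged b.

Definition multi_index := {ffun box -> 'I_n}.

(* Tensors on R^n of order [sum_i lam i], given by their coordinates. *)
Definition tensor := {ffun multi_index -> R^o}.

Definition tact (g : orthogonal R n) (T : tensor) : tensor :=
  [ffun i : multi_index =>
    \sum_(j : multi_index) (\prod_(b : box) g (i b) (j b)) * T j].

Definition traceless (T : tensor) : Prop :=
  forall (b c : box) (i : multi_index), b != c ->
    \sum_(a < n) T [ffun x => if (x == b) || (x == c) then a else i x] = 0.

Definition row_stab : {set {perm box}} :=
  [set s : {perm box} | [forall b, box_row (s b) == box_row b]].

Definition col_stab : {set {perm box}} :=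
  [set s : {perm box} | [forall b, box_col (s b) == box_col b]].

Definition tperm_act (s : {perm box}) (T : tensor) : tensor :=
  [ffun i : multi_index => T [ffun b => i (s b)]].

Definition young_symmetrizer (T : tensor) : tensor :=
  \sum_(c in col_stab) \sum_(r in row_stab)
    ((-1) ^+ odd_perm c) *: tperm_act c (tperm_act r T).

Definition weyl_module : set tensor :=
  [set T | traceless T /\ exists S, T = young_symmetrizer S]%classic.

(* [isotypic_component] is H^lam, the component of L^2 of the Grassmannian
   isomorphic to [weyl_module].  That module occurs at most once and is
   irreducible, so H^lam is the image of any nonzero intertwiner; its elements
   are taken to be the continuous functions representing the L^2 classes, for
   which point evaluation makes sense. *)
Definition intertwiner (Phi : tensor -> grassmannian R m n -> R) : Prop :=
  [/\ forall a S T p, weyl_module S -> weyl_module T ->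
        Phi (a *: S + T) p = a * Phi S p + Phi T p,
      forall g T p, weyl_module T -> Phi (tact g T) (gact g p) = Phi T p
    & forall T, weyl_module T -> continuous (Phi T)].

Definition isotypic_component : set (grassmannian R m n -> R) :=
  [set f | exists Phi T, [/\ intertwiner Phi, weyl_module T & f = Phi T]]%classic.

End WeylModule.

(* [grassmannian_design D t] says that [D] is a [2t]-design. *)
Definition grassmannian_design (R : realType) (m n : nat)
    (D : {fset grassmannian R m n}) (t : nat) : Prop :=
  forall mu : m.-tuple nat, sorted geq mu -> (1 <= sumn mu <= t)%N ->
  forall f, isotypic_component (fun i => 2 * tnth mu i)%N f ->
    \sum_(x <- D) f x = 0.

Definition sigma_energy (R : realType) (m n : nat)
    (D : {fset grassmannian R m n}) (t : nat) : R :=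
  (\sum_(p <- D) \sum_(q <- D) sigma p q ^+ t) / (#|` D|%:R ^+ 2).

(* Main.v *)
(* Write P_p for the orthogonal projection onto p, so that sigma(p, q)^t is the
   inner product of the tensors P_p^t (t-fold tensor powers).  Let E be the point
   of least norm in the affine hull of all the P_p^t.  It is O(n)-invariant and
   <E, P_p^t> = |E|^2 for every p, hence the energy of D is |E|^2 + |avg_D - E|^2
   where avg_D is the average of the P_p^t over D.  So c = |E|^2 is a lower bound,
   attained iff avg_D = E, that is, iff averaging over D agrees with E on all
   functions p |-> <P_p^t, v>.  It remains to compare these functions, which are
   the polynomials of degree <= t in the entries of P_p, with the components
   H^(2 mu), deg mu <= t.

   Every function of H^(2 mu) is such a polynomial, and E kills it if mu <> 0.
   By the Riesz representation, the first claim is about tensors invariant under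
   the stabilizer O(m) x O(n - m), and the second about O(n)-invariant tensors;
   both follow from the first fundamental theorem, i.e. such tensors are spanned
   by pairings.  For this take an invariant w orthogonal to all pairings.  With A
   a (block) matrix of independent Gaussian entries, <w, A^k z> has expectation 0
   for all z, by Wick's formula.  Choose for z the component of w whose content
   has the lowest weight: writing A = Q R with Q orthogonal and R upper triangular,
   <w, A^k z> = <w, R^k z> is a product of even powers of the diagonal entries of
   R times |z|^2, hence nonnegative, and it is |z|^2 at A = 1.  So z = 0, and w = 0.

   Conversely, every polynomial of degree k in P_p is a combination of functions
   from the H^(2 mu), deg mu <= k.  Otherwise some nonzero x in the span of the
   S^k, S = A^T A of rank <= m, is orthogonal to the images of all the Young
   symmetrizers of shape 2 mu, deg mu = k (their traces only contribute polynomials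
   of lower degree).  The space of such x is stable under all matrices; its
   components of lowest weight are multiplied by the diagonal monomial r^nu under
   upper triangular matrices, and evaluating on S = R^T R shows that nu = 2 mu is an
   even partition with at most m parts and that such a component acts on the S^k as
   a multiple of the symmetrized highest weight tensor of shape 2 mu, to which it is
   orthogonal. *)

Require Import Defs.
From HB Require Import structures.
From mathcomp Require Import all_boot all_order all_algebra all_fingroup finmap.
From mathcomp Require Import all_classical all_reals all_analysis.
From mathcomp Require Import zify ring lra.
Set Implicit Arguments.
Unset Strict Implicit.
Unset Printing Implicit Defensive.
Import Order.TTheory GRing.Theory Num.Theory.
Import numFieldNormedType.Exports.
Local Open Scope ring_scope.

(** * Euclidean geometry of finite function spaces *)

Section Dot.
Variables (R : realType) (I : finType).
Implicit Types x y z : {ffun I -> R^o}.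

Definition dot x y : R := \sum_i x i * y i.

Lemma dotC x y : dot x y = dot y x.
Proof. by apply: eq_bigr => i _; rewrite mulrC. Qed.

Lemma dotP a x y z : dot (a *: x + y) z = a * dot x z + dot y z.
Proof.
rewrite /dot mulr_sumr -big_split; apply: eq_bigr => i _.
by rewrite !ffunE mulrDl mulrA.
Qed.

Lemma dotPr a x y z : dot z (a *: x + y) = a * dot z x + dot z y.
Proof. by rewrite dotC dotP ![dot _ z]dotC. Qed.

Lemma dot0l x : dot 0 x = 0.
Proof. by apply: big1 => i _; rewrite ffunE mul0r. Qed.

Lemma dot0r x : dot x 0 = 0.
Proof. by rewrite dotC dot0l. Qed.

Lemma dotDl x y z : dot (x + y) z = dot x z + dot y z.
Proof. by rewrite -[x in LHS]scale1r dotP mul1r. Qed.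

Lemma dotDr x y z : dot z (x + y) = dot z x + dot z y.
Proof. by rewrite dotC dotDl ![dot _ z]dotC. Qed.

Lemma dotZl a x z : dot (a *: x) z = a * dot x z.
Proof. by rewrite -[_ *: _]addr0 dotP dot0l addr0. Qed.

Lemma dotZr a x z : dot z (a *: x) = a * dot z x.
Proof. by rewrite dotC dotZl dotC. Qed.

Lemma dotBl x y z : dot (x - y) z = dot x z - dot y z.
Proof. by rewrite -scaleN1r dotDl dotZl mulN1r. Qed.

Lemma dotBr x y z : dot z (x - y) = dot z x - dot z y.
Proof. by rewrite dotC dotBl ![dot _ z]dotC. Qed.

Lemma dot_sumr (J : Type) (r : seq J) (P : pred J) F z :
  dot z (\sum_(j <- r | P j) F j) = \sum_(j <- r | P j) dot z (F j).
Proof. by elim/big_rec2: _ => [|j u v _ <-]; rewrite ?dot0r ?dotDr. Qed.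

Lemma dot_ge0 x : 0 <= dot x x.
Proof. by apply: sumr_ge0 => i _; rewrite -expr2 sqr_ge0. Qed.

Lemma dot_eq0 x : dot x x = 0 -> x = 0.
Proof.
move=> /eqP; rewrite psumr_eq0 => [/allP xx|i _]; last by rewrite -expr2 sqr_ge0.
by apply/ffunP => i; have := xx i; rewrite mem_index_enum mulf_eq0 orbb ffunE
  => /(_ isT) /eqP.
Qed.

Definition basis_vec (i : I) : {ffun I -> R^o} := [ffun j => (j == i)%:R].

Lemma dot_basis x i : dot x (basis_vec i) = x i.
Proof.
rewrite /dot (bigD1 i) //= ffunE eqxx mulr1 big1 ?addr0 // => j /negPf ji.
by rewrite ffunE ji mulr0.
Qed.

End Dot.

(** Subspaces are encoded as propositional predicates, since those used below are cut out by
    undecidable conditions, for instance that an associated function belongs to a given class. *)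
Definition lin_closed (R : realType) (V : lmodType R) (A : V -> Prop) :=
  A 0 /\ forall a x y, A x -> A y -> A (a *: x + y).

Section LinClosed.
Variables (R : realType) (V : lmodType R) (A : V -> Prop).
Hypothesis Alin : lin_closed A.

Lemma lin_closedD x y : A x -> A y -> A (x + y).
Proof. by move=> Ax Ay; rewrite -[x]scale1r; apply: Alin.2. Qed.

Lemma lin_closedZ a x : A x -> A (a *: x).
Proof. by move=> Ax; rewrite -[_ *: _]addr0; apply: Alin.2 => //; exact: Alin.1. Qed.

Lemma lin_closedB x y : A x -> A y -> A (x - y).
Proof. by move=> Ax Ay; rewrite addrC -scaleN1r; apply: Alin.2. Qed.

Lemma lin_closed_sum (J : Type) (r : seq J) (P : pred J) (F : J -> V) :
  (forall j, P j -> A (F j)) -> A (\sum_(j <- r | P j) F j).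
Proof. by move=> AF; elim/big_ind: _ => //; [exact: Alin.1|exact: lin_closedD]. Qed.

End LinClosed.

Section Projection.
Variables (R : realType) (I : finType).
Local Notation V := {ffun I -> R^o}.
Variable A : V -> Prop.
Hypothesis Alin : lin_closed A.

(* The approximant must stay in the span of [X] for the induction. *)
Lemma seq_proj (X : seq V) (v : V) : exists a : V,
  (forall B : V -> Prop, lin_closed B -> (forall x, x \in X -> B x) -> B a) /\
  forall x, x \in X -> dot (v - a) x = 0.
Proof.
elim: X v => [|x X IH] v; first by exists 0; split=> // B [].
have [b [Ab bX]] := IH x; have [a [Aa aX]] := IH v.
(* Gram-Schmidt: [u] is the part of [x] orthogonal to [X]. If [dot u u = 0] then [u = 0], and the
   value of the quotient [c] is immaterial. *)
set u := x - b; set c := dot (v - a) u / dot u u.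
exists (c *: u + a); split=> [B Bl BX|].
  have BX' y : y \in X -> B y by move=> yX; apply: BX; rewrite inE yX orbT.
  apply: Bl.2; last exact: Aa.
  by apply: (lin_closedB Bl); [apply: BX; rewrite mem_head|exact: Ab].
have ortX y : y \in X -> dot (v - (c *: u + a)) y = 0.
  by move=> yX; rewrite opprD addrCA dotDl -scaleNr dotZl bX // mulr0 add0r aX.
move=> y; rewrite inE => /orP[/eqP ->|]; last exact: ortX.
have -> : x = u + b by rewrite subrK.
rewrite dotDr [X in _ + X](Ab (fun z => dot _ z = 0)) ?addr0 //; last first.
  by split=> [|d s r Hs Hr]; rewrite ?dot0r // dotPr Hs Hr mulr0 addr0.
rewrite opprD addrCA addrC dotDl -scaleNr dotZl mulNr.
have [u0|u0] := eqVneq (dot u u) 0.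
  by rewrite (dot_eq0 u0) !dot0r mulr0 subr0.
by rewrite /c divfK // subrr.
Qed.

(** A vector space of maximal dimension contained in [A] is all of [A]; its basis is the finite
    family to which [seq_proj] applies. *)
Lemma lin_proj (v : V) :
  exists2 a, A a & forall x, A x -> dot (v - a) x = 0.
Proof.
pose P d := `[< exists2 U : {vspace V}, \dim U = d & forall x, x \in U -> A x >].
have exP : exists d, P d.
  exists 0%N; apply/asboolP; exists 0%VS; first exact: dimv0.
  by move=> x; rewrite memv0 => /eqP ->; exact: Alin.1.
have ubP d : P d -> (d <= \dim {:V})%N.
  by move=> /asboolP[U <- _]; exact: dimvS (subvf _).
have [d /asboolP[U dU UA] dmax] := ex_maxnP exP ubP.
have AU x : A x -> x \in U.
  move=> Ax; apply: contraT => xU.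
  have : P (\dim (U + <[x]>)%VS).
    apply/asboolP; exists (U + <[x]>)%VS => // _ /memv_addP[y yU [z /vlineP[c ->] ->]].
    by rewrite addrC; apply: Alin.2 => //; exact: UA.
  move=> /dmax; rewrite -dU leqNgt.
  have -> // : (\dim U < \dim (U + <[x]>))%N.
  rewrite ltn_neqAle dimvS ?addvSl // andbT; apply: contra xU => /eqP eqd.
  have /eqP -> : U == (U + <[x]>)%VS by rewrite eqEdim addvSl eqd /=.
  by rewrite (subvP (addvSr _ _)) // memv_line.
have [a [Ha aX]] := seq_proj (vbasis U) v.
exists a; first by apply: Ha => // x xU; apply: UA; exact: vbasis_mem.
move=> x /AU xU; rewrite (coord_vbasis xU) dot_sumr big1 // => i _.
by rewrite dotZr aX ?mulr0 // mem_nth // size_tuple.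
Qed.

End Projection.

Section Riesz.
Variables (R : realType) (I : finType).
Local Notation V := {ffun I -> R^o}.
Variable A : V -> Prop.
Hypothesis Alin : lin_closed A.

(** Linearity is only asked on [A]. Take [x0] in [A] with [l x0 <> 0]: its component orthogonal to
    the kernel of [l] in [A] represents [l] up to a factor. *)
Lemma riesz (l : V -> R) :
  (forall a x y, A x -> A y -> l (a *: x + y) = a * l x + l y) ->
  exists2 w, A w & forall x, A x -> l x = dot w x.
Proof.
move=> llin.
have l0 : l 0 = 0.
  have := llin 1 0 0 Alin.1 Alin.1; rewrite scaler0 addr0 mul1r => /eqP.
  by rewrite -subr_eq0 opprD addrA subrr sub0r oppr_eq0 => /eqP.
pose N x := A x /\ l x = 0.
have Nlin : lin_closed N.
  split=> [|a x y [Ax lx] [Ay ly]]; first by split=> //; exact: Alin.1.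
  by split; [exact: Alin.2|rewrite llin // lx ly mulr0 addr0].
have [[x0 Ax0 lx0]|H] := pselect (exists2 x, A x & l x <> 0); last first.
  exists 0; [exact: Alin.1|move=> x Ax; rewrite dot0l].
  by apply: contra_notP H => lx; exists x.
have [a [Aa la] aN] := lin_proj Nlin x0.
set u := x0 - a.
have Au : A u by exact: lin_closedB.
have lu : l u = l x0 by rewrite /u addrC -scaleN1r llin // la mulr0 add0r.
have uu : dot u u != 0.
  by apply/eqP => /dot_eq0 u0; apply: lx0; rewrite -lu u0 l0.
exists ((l u / dot u u) *: u); first exact: lin_closedZ.
move=> x Ax; rewrite dotZl.
have Nx : N (- (l x / l u) *: u + x).
  split; first exact: Alin.2.
  rewrite llin // mulNr divfK ?addNr //.
  by rewrite lu; apply/eqP.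
have /eqP := aN _ Nx; rewrite dotPr mulNr addrC subr_eq0 => /eqP ->.
have lu0 : l u != 0 by rewrite lu; apply/eqP.
by field; rewrite lu0 uu.
Qed.

End Riesz.

(** * Tensors and pairings *)

Notation tens R n B := {ffun {ffun B -> 'I_n} -> R^o}.

Section Tensors.
Variables (R : realType) (n : nat).
Implicit Types g h : 'M[R]_n.

(** The formula of [tact], for arbitrary matrices: triangular, diagonal and singular ones act below
    as well. *)
Definition mact (B : finType) g (T : tens R n B) : tens R n B :=
  [ffun i : {ffun B -> 'I_n} =>
    \sum_(j : {ffun B -> 'I_n}) (\prod_(b : B) g (i b) (j b)) * T j].

Lemma mactP (B : finType) g a (S T : tens R n B) :
  mact g (a *: S + T) = a *: mact g S + mact g T.
Proof.
apply/ffunP => i; rewrite !ffunE /GRing.scale /= mulr_sumr -big_split /=.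
by apply: eq_bigr => j _; rewrite !ffunE /GRing.scale /= mulrDr mulrCA.
Qed.

Lemma mactB (B : finType) g (S T : tens R n B) : mact g (S - T) = mact g S - mact g T.
Proof. by rewrite addrC -scaleN1r mactP scaleN1r addrC. Qed.

Lemma mact_dot (B : finType) g (S T : tens R n B) :
  dot (mact g S) T = dot S (mact g^T T).
Proof.
rewrite /dot; under eq_bigr do rewrite ffunE mulr_suml.
rewrite exchange_big /=; apply: eq_bigr => j _.
rewrite ffunE mulr_sumr; apply: eq_bigr => i _.
rewrite mulrAC mulrC; congr (_ * (_ * _)).
by apply: eq_bigr => b _; rewrite mxE.
Qed.

Lemma mactM (B : finType) g h (T : tens R n B) : mact g (mact h T) = mact (g *m h) T.
Proof.
apply/ffunP => i; rewrite !ffunE.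
under eq_bigr do rewrite ffunE mulr_sumr.
rewrite exchange_big /=; apply: eq_bigr => j _.
under eq_bigr do rewrite mulrA -big_split.
rewrite -mulr_suml; congr (_ * _).
under [RHS]eq_bigr do rewrite mxE.
by rewrite bigA_distr_bigA.
Qed.

Lemma mact1 (B : finType) (T : tens R n B) : mact 1%:M T = T.
Proof.
apply/ffunP => i; rewrite ffunE (bigD1 i) //= [X in X * _]big1 => [|b _]; last first.
  by rewrite mxE eqxx.
rewrite mul1r big1 ?addr0 //.
move=> j ji; have [b ijb] : exists b, i b != j b.
  apply/existsP; apply: contraR ji; rewrite negb_exists => /forallP ij.
  by apply/eqP/ffunP => b; have := ij b; rewrite negbK => /eqP.
by rewrite (bigD1 b) //= mxE (negPf ijb) mulr0n !mul0r.
Qed.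

(** The tensor product of the matrices [X a], each placed on the two factors [h (a, false)] and
    [h (a, true)]. Powers of a projection and invariant pairings both have this form. *)
Definition ptens (A B : finType) (h : A * bool -> B) (X : A -> 'M[R]_n) : tens R n B :=
  [ffun i : {ffun B -> 'I_n} => \prod_a X a (i (h (a, false))) (i (h (a, true)))].

Lemma mact_ptens (A B : finType) (h : A * bool -> B) X g : bijective h ->
  mact g (ptens h X) = ptens h (fun a => g *m X a *m g^T).
Proof.
move=> [h' hK h'K]; apply/ffunP => i; rewrite !ffunE.
pose J (k : {ffun A -> 'I_n * 'I_n}) : {ffun B -> 'I_n} :=
  [ffun b => if (h' b).2 then (k (h' b).1).2 else (k (h' b).1).1].
pose K (j : {ffun B -> 'I_n}) : {ffun A -> 'I_n * 'I_n} :=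
  [ffun a => (j (h (a, false)), j (h (a, true)))].
rewrite (reindex J) /=; last first.
  exists K => j _; apply/ffunP => x; rewrite !ffunE.
    by rewrite !hK /=; case: (j x).
  by move: (h'K x); case: (h' x) => a [] /= ->.
transitivity (\sum_(k : {ffun A -> 'I_n * 'I_n}) \prod_a
   (g (i (h (a, false))) (k a).1 * g (i (h (a, true))) (k a).2 *
    X a (k a).1 (k a).2)).
  apply: eq_bigr => k _; rewrite ffunE big_split /=; congr (_ * _).
    rewrite (reindex h) /=; last by exists h' => x _; rewrite ?hK ?h'K.
    have -> : \prod_(x : A * bool) g (i (h x)) (J k (h x)) =
       \prod_(a : A) \prod_(e : bool) g (i (h (a, e))) (J k (h (a, e))).
      by rewrite pair_bigA; apply: eq_bigr => -[].
    by apply: eq_bigr => a _; rewrite big_bool !ffunE !hK /= mulrC.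
  by apply: eq_bigr => a _; rewrite !ffunE !hK.
rewrite -(bigA_distr_bigA (fun a (k : 'I_n * 'I_n) =>
   g (i (h (a, false))) k.1 * g (i (h (a, true))) k.2 * X a k.1 k.2)).
apply: eq_bigr => a _; rewrite mxE.
under [RHS]eq_bigr do rewrite mxE mulr_suml.
rewrite exchange_big /= pair_bigA /=; apply: eq_bigr => -[x y] _ /=.
by rewrite mxE mulrAC.
Qed.

Definition reidx (B C : finType) (h : C -> B) (T : tens R n C) : tens R n B :=
  [ffun i : {ffun B -> 'I_n} => T [ffun c => i (h c)]].

Lemma reidx_dot (B C : finType) (h : C -> B) (T : tens R n C) (S : tens R n B) (h' : B -> C) :
  cancel h h' -> cancel h' h -> dot S (reidx h T) = dot (reidx h' S) T.
Proof.
move=> hK h'K; rewrite /dot (reindex (fun i : {ffun C -> 'I_n} => [ffun b => i (h' b)])) /=.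
  apply: eq_bigr => i _; rewrite !ffunE; congr (_ * T _).
  by apply/ffunP => c; rewrite !ffunE hK.
exists (fun i : {ffun B -> 'I_n} => [ffun c => i (h c)]) => i _; apply/ffunP => x;
  by rewrite !ffunE ?hK ?h'K.
Qed.

Lemma reidx_mact (B C : finType) (h : C -> B) g (T : tens R n C) : bijective h ->
  mact g (reidx h T) = reidx h (mact g T).
Proof.
move=> [h' hK h'K]; apply/ffunP => i; rewrite !ffunE.
rewrite (reindex (fun i : {ffun C -> 'I_n} => [ffun b => i (h' b)])) /=.
  apply: eq_bigr => j _; rewrite !ffunE; congr (_ * T _).
    rewrite (reindex h) /=; last by exists h' => x _; rewrite ?hK ?h'K.
    by apply: eq_bigr => c _; rewrite !ffunE hK.
  by apply/ffunP => c; rewrite !ffunE hK.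
exists (fun i : {ffun B -> 'I_n} => [ffun c => i (h c)]) => j _; apply/ffunP => x;
  by rewrite !ffunE ?hK ?h'K.
Qed.

Lemma reidx_ptens (A B C : finType) (h : C -> B) (k : A * bool -> C) X :
  reidx h (ptens k X) = ptens (h \o k) X.
Proof. by apply/ffunP => i; rewrite !ffunE; apply: eq_bigr => a _; rewrite !ffunE. Qed.

End Tensors.

(** * QR decomposition of block matrices *)

Section QR.
Variable R : realType.

(** Block diagonal for the two classes of indices coloured by [bl]; a constant [bl] imposes no
    condition. *)
Definition compat n (bl : 'I_n -> bool) (A : 'M[R]_n) :=
  forall i j, bl i != bl j -> A i j = 0.

Definition upper n (A : 'M[R]_n) := forall i j : 'I_n, (j < i)%N -> A i j = 0.

Lemma compatM n (bl : 'I_n -> bool) (A B : 'M[R]_n) :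
  compat bl A -> compat bl B -> compat bl (A *m B).
Proof.
move=> cA cB i j ij; rewrite mxE big1 // => k _.
have [ik|ik] := eqVneq (bl i) (bl k); last by rewrite cA ?mul0r.
by rewrite cB ?mulr0 // -ik.
Qed.

(** Reflection in the hyperplane orthogonal to [v = a - |a| e_0]. It is block diagonal because [v]
    is supported on the block of index 0. *)
Lemma householder k (a : 'cV[R]_k.+1) (bl : 'I_k.+1 -> bool) :
  (forall i, bl i != bl ord0 -> a i 0 = 0) ->
  exists H : 'M[R]_k.+1,
    [/\ H *m H^T = 1%:M, compat bl H & forall i, i != ord0 -> (H *m a) i 0 = 0].
Proof.
move=> abl; pose N := \sum_i a i 0 ^+ 2; pose al := Num.sqrt N.
have alal : al ^+ 2 = N by rewrite sqr_sqrtr // sumr_ge0 // => i _; exact: sqr_ge0.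
pose v : 'cV[R]_k.+1 := \col_i (a i 0 - al * (i == ord0)%:R).
pose s := \sum_i v i 0 ^+ 2; pose tau := \sum_i v i 0 * a i 0.
have N0 : N = a ord0 0 ^+ 2 + \sum_(i < k) a (lift ord0 i) 0 ^+ 2.
  by rewrite /N big_ord_recl.
have s0 : s = (a ord0 0 - al) ^+ 2 + \sum_(i < k) a (lift ord0 i) 0 ^+ 2.
  rewrite /s big_ord_recl mxE eqxx mulr1; congr (_ + _).
  by apply: eq_bigr => i _; rewrite mxE /= mulr0 subr0.
have tau0 : tau = (a ord0 0 - al) * a ord0 0 + \sum_(i < k) a (lift ord0 i) 0 ^+ 2.
  rewrite /tau big_ord_recl mxE eqxx mulr1; congr (_ + _).
  by apply: eq_bigr => i _; rewrite mxE /= mulr0 subr0 expr2.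
have s2 : s = 2 * tau by move: alal; rewrite s0 tau0 N0; lra.
have vv : v^T *m v = s%:M.
  rewrite [LHS]mx11_scalar; congr (_%:M); rewrite mxE.
  by apply: eq_bigr => i _; rewrite mxE expr2.
have va : v^T *m a = tau%:M.
  rewrite [LHS]mx11_scalar; congr (_%:M); rewrite mxE.
  by apply: eq_bigr => i _; rewrite mxE.
have v0 : s = 0 -> v = 0.
  move=> /eqP; rewrite psumr_eq0 => [/allP h|i _]; last exact: sqr_ge0.
  apply/matrixP => i j; rewrite (ord1 j) [RHS]mxE.
  by have := h i; rewrite mem_index_enum sqrf_eq0 => /(_ isT) /eqP.
(* If [s = 0] then [v = 0] and [a] already lies on the axis; the convention [2 / 0 = 0] then gives
   [H = 1]. *)
pose c := 2 / s; pose H := 1%:M - c *: (v *m v^T).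
have cs : c * (c * s) = 2 * c.
  by rewrite /c; have [->|s1] := eqVneq s 0; [rewrite invr0 !mulr0|field].
have HT : H^T = H by rewrite /H linearB linearZ /= trmx_mul trmxK trmx1.
exists H; split.
- have WW : v *m v^T *m (v *m v^T) = s *: (v *m v^T).
    by rewrite -mulmxA [v^T *m _]mulmxA vv mul_scalar_mx -scalemxAr.
  rewrite HT /H mulmxBl mul1mx mulmxBr mulmx1 -scalemxAl -scalemxAr WW !scalerA -mulrA cs.
  have -> : 2 * c = c + c by ring.
  by rewrite scalerDl !opprD !opprK !addrA !subrK.
- move=> i j ij; rewrite !mxE big_ord1 !mxE.
  have -> : (i == j) = false by apply: contraNF ij => /eqP ->.
  rewrite mulr0n sub0r.
  have [bi|bi] := eqVneq (bl i) (bl ord0).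
    have bj : bl j != bl ord0 by rewrite -bi eq_sym.
    have -> : (j == ord0) = false by apply: contraNF bj => /eqP ->.
    by rewrite (abl j) //= mulr0 subr0 !mulr0 oppr0.
  have -> : (i == ord0) = false by apply: contraNF bi => /eqP ->.
  by rewrite (abl i) //= mulr0 subr0 mul0r mulr0 oppr0.
- move=> i i0; rewrite /H mulmxBl mul1mx -scalemxAl -mulmxA va mul_mx_scalar scalerA.
  have vi : v i 0 = a i 0 by rewrite mxE (negPf i0) mulr0 subr0.
  rewrite 3!mxE vi; have [z0|z0] := eqVneq s 0.
    by rewrite -vi v0 // mxE mulr0 subr0.
  have -> : c * tau = 1 by rewrite /c -[tau](mulKf (_ : 2 != 0)) // -s2; field.
  by rewrite mul1r subrr.
Qed.

(** A Householder reflection clears the first column; recursion treats the lower right block, with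
    the colouring restricted to it. *)
Lemma qr_compat n (bl : 'I_n -> bool) (A : 'M[R]_n) : compat bl A ->
  exists Q : 'M[R]_n, [/\ Q *m Q^T = 1%:M, compat bl Q & upper (Q *m A)].
Proof.
elim: n bl A => [|n IH] bl A cA.
  by exists 1%:M; split=> [|[]|[]] //; rewrite trmx1 mulmx1.
have [|H [HH cH H0]] := @householder n (col ord0 A) bl.
  by move=> i bi; rewrite mxE cA.
set B := H *m A.
have cB : compat bl B by exact: compatM.
have B0 i : i != ord0 -> B i ord0 = 0.
  by move=> /H0 <-; rewrite !mxE; apply: eq_bigr => k _; rewrite mxE.
have [|Q [QQ cQ uQ]] := IH (bl \o lift ord0) (\matrix_(i, j) B (lift ord0 i) (lift ord0 j)).
  by move=> i j ij; rewrite mxE cB.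
pose G : 'M[R]_n.+1 := \matrix_(i, j)
  match unlift ord0 i, unlift ord0 j with
  | Some i', Some j' => Q i' j' | None, None => 1 | _, _ => 0 end.
have G00 : G ord0 ord0 = 1 by rewrite mxE unlift_none.
have G0l j : G ord0 (lift ord0 j) = 0 by rewrite mxE unlift_none liftK.
have Gl0 j : G (lift ord0 j) ord0 = 0 by rewrite mxE unlift_none liftK.
have Gll i j : G (lift ord0 i) (lift ord0 j) = Q i j by rewrite mxE !liftK.
have GT i j : G^T i j = G j i by rewrite mxE.
have GG : G *m G^T = 1%:M.
  apply/matrixP => i j; rewrite mxE big_ord_recl GT.
  case: (unliftP ord0 i) => [i'|] ->; case: (unliftP ord0 j) => [j'|] ->;
    rewrite ?(G00, G0l, Gl0).
  - rewrite mul0r add0r [RHS]mxE (inj_eq lift_inj).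
    have /matrixP/(_ i' j') := QQ; rewrite !mxE => <-.
    by apply: eq_bigr => k _; rewrite GT !Gll mxE.
  - rewrite mul0r add0r big1 ?mxE // => k _.
    by rewrite GT G0l mulr0.
  - rewrite mulr0 add0r big1 ?mxE // => k _.
    by rewrite G0l mul0r.
  - rewrite mul1r big1 ?addr0 ?mxE // => k _.
    by rewrite G0l mul0r.
exists (G *m H); split.
- by rewrite trmx_mul mulmxA -[G *m H *m _]mulmxA HH mulmx1.
- apply: compatM => // i j; case: (unliftP ord0 i) => [i'|] ->;
    case: (unliftP ord0 j) => [j'|] ->; rewrite ?Gll ?G0l ?Gl0 ?eqxx //.
  exact: cQ.
- move=> i j; rewrite -mulmxA -/B; case: (unliftP ord0 i) => [i'|] -> ij; last by [].
  rewrite mxE big_ord_recl Gl0 mul0r add0r; move: ij.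
  case: (unliftP ord0 j) => [j'|] -> ij; last first.
    by rewrite big1 // => k _; rewrite B0 ?mulr0.
  have := uQ i' j'; rewrite /= /bump /= !add1n ltnS in ij * => /(_ ij) e.
  by rewrite -[RHS]e [RHS]mxE; apply: eq_bigr => k _; rewrite Gll [in RHS]mxE.
Qed.

Lemma qr n (A : 'M[R]_n) :
  exists Q : 'M[R]_n, Q *m Q^T = 1%:M /\ upper (Q *m A).
Proof.
by have [|Q [QQ _ uQ]] := @qr_compat n xpredT A; [|exists Q].
Qed.

End QR.

(** * Gaussian moments *)

Section GaussianMoments.
Variable R : realType.
Implicit Types p q h : {poly R}.

(** Moments of the standard normal law: 0 for odd [k], and (k-1)!! for even [k]. The expectation
    [gauss] is defined from them algebraically, without integrals. *)
Fixpoint gmoment (k : nat) : R :=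
  if k is k'.+2 then k'.+1%:R * gmoment k' else (k == 0)%:R.

Lemma gmomentSS k : gmoment k.+2 = k.+1%:R * gmoment k.
Proof. by []. Qed.

Definition gauss p : R := \sum_(i < size p) p`_i * gmoment i.

Lemma gauss_widen p k : (size p <= k)%N -> gauss p = \sum_(i < k) p`_i * gmoment i.
Proof.
move=> pk; rewrite /gauss (big_ord_widen k (fun i => p`_i * gmoment i) pk) big_mkcond /=.
apply: eq_bigr => i _; case: ltnP => // ki.
by rewrite nth_default ?mul0r.
Qed.

Lemma gaussP a p q : gauss (a *: p + q) = a * gauss p + gauss q.
Proof.
pose k := maxn (size (a *: p + q)) (maxn (size p) (size q)).
rewrite !(@gauss_widen _ k) ?leq_max ?leqnn ?orbT // mulr_sumr -big_split /=.
by apply: eq_bigr => i _; rewrite coefD coefZ mulrDl mulrA.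
Qed.

Lemma gauss0 : gauss 0 = 0.
Proof. by rewrite /gauss size_poly0 big_ord0. Qed.

Lemma gaussD p q : gauss (p + q) = gauss p + gauss q.
Proof. by rewrite -[p]scale1r gaussP mul1r scale1r. Qed.

Lemma gaussZ a p : gauss (a *: p) = a * gauss p.
Proof. by rewrite -[_ *: _]addr0 gaussP gauss0 addr0. Qed.

Lemma gauss_sum (J : Type) (r : seq J) (P : pred J) F :
  gauss (\sum_(j <- r | P j) F j) = \sum_(j <- r | P j) gauss (F j).
Proof. by elim/big_rec2: _ => [|j u v _ <-]; rewrite ?gauss0 ?gaussD. Qed.

Lemma gaussXn k : gauss 'X^k = gmoment k.
Proof.
rewrite /gauss size_polyXn big_ord_recr /= coefXn eqxx mul1r big1 ?add0r // => i _.
by rewrite coefXn ltn_eqF // mul0r.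
Qed.

(** Gaussian integration by parts; on monomials it is the recursion of the moments. *)
Lemma gauss_stein p : gauss ('X * p) = gauss p^`().
Proof.
rewrite -[p]coefK poly_def mulr_sumr raddf_sum !gauss_sum.
apply: eq_bigr => -[[|i] /= _] _.
  by rewrite expr0 alg_polyC mulrC mul_polyC gaussZ derivC gauss0 -['X]expr1 gaussXn mulr0.
rewrite -scalerAr derivZ !gaussZ -exprS gaussXn derivXn /=.
by rewrite -(scaler_nat i.+1 'X^i) gaussZ gaussXn.
Qed.

(** The probabilists' Hermite polynomials. *)
Fixpoint hermite (k : nat) : {poly R} :=
  if k is k'.+1 then 'X * hermite k' - (hermite k')^`() else 1.

(** By integration by parts, multiplication by ['X] minus derivation is adjoint to derivation. In
    particular [hermite k] is orthogonal to all polynomials of degree less than [k]. *)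
Lemma gauss_hermite k q : gauss (hermite k * q) = gauss q^`(k).
Proof.
elim: k q => [|k IH] q; first by rewrite mul1r.
rewrite /= mulrBl -mulrA -scaleN1r addrC gaussP mulN1r gauss_stein derivM gaussD.
by rewrite addrA addNr add0r IH -derivSn.
Qed.

Lemma hermite_monic k : size (hermite k) = k.+1 /\ hermite k \is monic.
Proof.
elim: k => [|k [sk mk]]; first by rewrite size_poly1 monic1.
have k0 : hermite k != 0 by rewrite -size_poly_eq0 sk.
have sX : size ('X * hermite k) = k.+2 by rewrite mulrC size_mulX // sk.
have sd : (size (- (hermite k)^`()) < size ('X * hermite k)%R)%N.
  by rewrite size_polyN sX (leq_trans (lt_size_deriv k0)) // sk.
split; first by rewrite /= size_polyDl.
by rewrite monicE /= lead_coefDl // lead_coefM lead_coefX mul1r.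
Qed.

(** Write [h = c He_d + r] with [r] of degree less than [d]. The cross terms vanish and [He_d] has
    squared norm [d!], which leaves [c^2 d!] plus the expectation of [r^2], treated by induction. *)
Lemma gauss_sqr_gt0 h : h != 0 -> 0 < gauss (h * h).
Proof.
have [k] := ubnP (size h); elim: k h => // k IH h hk h0.
set d := (size h).-1; set c := lead_coef h.
have c0 : c != 0 by rewrite lead_coef_eq0.
have sh : size h = d.+1 by rewrite prednK // size_poly_gt0.
have [sd md] := hermite_monic d.
set r := h - c *: hermite d.
have sr : (size r <= d)%N.
  apply/leq_sizeP => j; rewrite leq_eqVlt => /orP[/eqP <-|dj]; rewrite coefB coefZ.
    have := md; rewrite monicE /lead_coef sd /= => /eqP ->.
    by rewrite mulr1 /c /lead_coef subrr.
  by rewrite !nth_default ?sd ?sh // mulr0 subr0.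
have dr : r^`(d) = 0 by apply/eqP; rewrite -size_poly_eq0 -leqn0; 
  apply/leq_sizeP => j _; rewrite coef_derivn nth_default ?mul0rn // (leq_trans sr) // leq_addr.
have hE : h = c *: hermite d + r by rewrite addrC subrK.
clearbody r.
have cross : gauss (hermite d * r) = 0 by rewrite gauss_hermite dr gauss0.
have diag : gauss (hermite d * hermite d) = d`!%:R.
  rewrite gauss_hermite; have -> : (hermite d)^`(d) = d`!%:R%:P.
    apply/polyP => j; rewrite coef_derivn coefC; case: j => [|j].
      rewrite addn0 ffactnn /= -[X in X *+ _](_ : 1 = _) //.
      by have := md; rewrite monicE /lead_coef sd /= => /eqP.
    by rewrite nth_default ?mul0rn // sd addnS ltnS leq_addr.
  by rewrite -[_%:P]mulr1 mul_polyC gaussZ -(expr0 'X) gaussXn /= mulr1.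
rewrite {1 2}hE mulrDl !mulrDr -!scalerAl -!scalerAr [r * hermite d]mulrC !gaussD !gaussZ.
rewrite cross diag !mulr0 addr0 add0r mulrA -expr2.
have cd : 0 < c ^+ 2 * d`!%:R.
  by rewrite mulr_gt0 ?ltr0n ?fact_gt0 // exprn_even_gt0.
have [->|r0] := eqVneq r 0; first by rewrite mulr0 gauss0 addr0.
by rewrite addr_gt0 // IH // (leq_ltn_trans sr) // -sh.
Qed.

End GaussianMoments.

(** * Expectations of nonnegative polynomials in one variable *)

Section GaussianPositivity.
Variable R : realType.
Implicit Types p q h : {poly R}.

(** Induction on the degree: far from 0, [|q|] stays above some [e > 0], so that [|q x|] exceeds
    [K + |c|] once [|x|] is large. *)
Lemma poly_growth q (c K : R) : q != 0 ->
  exists M : R, forall x, M <= `|x| -> K <= `|(q * 'X + c%:P).[x]|.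
Proof.
elim/poly_ind: q c K => [|q d IH] c K; first by rewrite eqxx.
move=> q0; have [e [M [e0 HM]]] : exists e M : R,
    0 < e /\ forall x, M <= `|x| -> e <= `|(q * 'X + d%:P).[x]|.
  have [q1|q1] := eqVneq q 0.
    exists `|d|, 0; split=> [|x _]; last by rewrite q1 mul0r add0r hornerC.
    by rewrite normr_gt0; apply: contraNneq q0 => ->; rewrite q1 mul0r add0r.
  by have [M HM] := IH d 1 q1; exists 1, M; split.
exists (Num.max M ((K + `|c|) / e)) => x.
rewrite ge_max => /andP[/HM ex]; rewrite ler_pdivrMr // => Kx.
rewrite hornerD hornerMX hornerC; set a := _.[x] in ex *.
have : `|a * x| <= `|a * x + c| + `|c| by rewrite -[X in `|X| <= _](addrK c) ler_normB.
have : `|x| * e <= `|a * x| by rewrite normrM mulrC ler_wpM2r.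
by move: Kx; lra.
Qed.

(** Outside a compact interval [p] exceeds [p.[0]]; inside it the extreme value theorem applies. *)
Lemma poly_min p : (forall x, 0 <= p.[x]) -> exists x0, forall x, p.[x0] <= p.[x].
Proof.
elim/poly_ind: p => [|q c _] p0; first by exists 0 => x; rewrite !horner0.
have [->|q0] := eqVneq q 0.
  by exists 0 => x; rewrite mul0r add0r !hornerC.
set p := _ + _ in p0 *.
have [M HM] := poly_growth c p.[0] q0.
have MM : - `|M| <= `|M| by rewrite -subr_ge0 opprK addr_ge0.
have [|x0 _ x0min] := @EVT_min R (fun x => p.[x]) (- `|M|) `|M| MM.
  by apply: continuous_subspaceT; exact: continuous_horner.
exists x0 => x; have [xM|xM] := lerP `|x| `|M|.
  by apply: x0min; rewrite in_itv /= -ler_norml.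
apply: (@le_trans _ _ p.[0]).
  by apply: x0min; rewrite in_itv /= -ler_norml normr0.
have := HM x (le_trans (ler_norm M) (ltW xM)); rewrite ger0_norm //.
Qed.

(** The sign of [s] selects the side of [a] on which [p] is known to be nonnegative; continuity does
    the rest. *)
Lemma poly_ge0_at p (a : R) (s : R) : s != 0 ->
  (forall x, 0 < s * (x - a) -> 0 <= p.[x]) -> 0 <= p.[a].
Proof.
move=> s0 Hp; rewrite leNgt; apply/negP => pa.
have /cvgrPdist_lt /(_ (- p.[a])) := @continuous_horner R p a.
rewrite oppr_gt0 => /(_ pa) /nbhs_ballP[e /= e0 He].
pose x := a + e / 2 * Num.sg s.
have xa : x - a = e / 2 * Num.sg s by rewrite /x addrC addKr.
have /He : ball a e x.
  rewrite /ball /= distrC xa normrM normr_sg s0 mulr1 gtr0_norm ?divr_gt0 //.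
  by rewrite ltr_pdivrMr // ltr_pMr // ltr1n.
have /Hp px : 0 < s * (x - a).
  by rewrite xa mulrCA mulr_gt0 ?divr_gt0 // mulrC -normrEsg normr_gt0.
rewrite ltr_norml => /andP[+ _]; rewrite opprK; lra.
Qed.

(** A minimum is a root of even order of [p - p.[x0]]: the first quotient changes sign at [x0], so
    it vanishes there too. *)
Lemma poly_sub_min p x0 : (forall x, p.[x0] <= p.[x]) ->
  exists2 q, p = p.[x0]%:P + ('X - x0%:P) * ('X - x0%:P) * q & forall x, 0 <= q.[x].
Proof.
move=> pmin.
have /factor_theorem[r rE] : root (p - p.[x0]%:P) x0.
  by rewrite rootE hornerD hornerN hornerC subrr.
have rx x : p.[x] - p.[x0] = r.[x] * (x - x0).
  have := congr1 (horner^~ x) rE.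
  by rewrite /= hornerD hornerN hornerC hornerM hornerXsubC.
have rp x : 0 < x - x0 -> 0 <= r.[x].
  by move=> xx; rewrite -(pmulr_lge0 _ xx) -rx subr_ge0.
have rn x : x - x0 < 0 -> r.[x] <= 0.
  by move=> xx; rewrite -(nmulr_lge0 _ xx) -rx subr_ge0.
have r0 : root r x0.
  rewrite rootE eq_le; apply/andP; split.
    rewrite -oppr_ge0 -hornerN; apply: (@poly_ge0_at _ _ (-1)).
      by rewrite oppr_eq0 oner_eq0.
    by move=> x; rewrite mulN1r oppr_gt0 hornerN oppr_ge0; exact: rn.
  by apply: (@poly_ge0_at _ _ 1) => [|x]; rewrite ?oner_eq0 // mul1r; exact: rp.
have /factor_theorem[q qE] := r0.
have qx x : p.[x] - p.[x0] = q.[x] * (x - x0) ^+ 2.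
  by rewrite rx qE hornerM hornerXsubC -mulrA expr2.
exists q.
  by rewrite -[LHS](subrK p.[x0]%:P) rE qE; ring.
have q1 x : 0 < 1 * (x - x0) -> 0 <= q.[x].
  rewrite mul1r => xx; rewrite -(pmulr_lge0 (x := (x - x0) ^+ 2)) ?exprn_gt0 //.
  by rewrite -qx subr_ge0.
move=> x; case: (ltrgtP x x0) => [xx|xx|->].
- rewrite -(pmulr_lge0 (x := (x - x0) ^+ 2)) -?qx ?subr_ge0 //.
  by rewrite exprn_even_gt0 //= subr_eq0 lt_eqF.
- by apply: q1; rewrite mul1r subr_gt0.
- by apply: (@poly_ge0_at _ _ 1); rewrite ?oner_eq0.
Qed.

(** With [x0] a minimum of [p], [h^2 p] is [p.[x0] h^2 + (h (X - x0))^2 q] where [q >= 0] has degree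
    two less than [p]. The square factor [h^2] is what makes this induction close. *)
Lemma gauss_sqr_mul_gt0 p h : h != 0 -> p != 0 -> (forall x, 0 <= p.[x]) ->
  0 < gauss (h * h * p).
Proof.
have [k] := ubnP (size p); elim: k p h => // k IH p h pk h0 p0 pge.
have [x0 /poly_sub_min[q pE qge]] := poly_min pge.
have hE : h * h * p = p.[x0] *: (h * h) +
    (h * ('X - x0%:P)) * (h * ('X - x0%:P)) * q.
  rewrite {1}pE mulrDr [_ * _%:P]mulrC mul_polyC; congr (_ + _); ring.
rewrite hE gaussP.
have hh : 0 < gauss (h * h) by exact: gauss_sqr_gt0.
have [q0|q0] := eqVneq q 0.
  rewrite q0 mulr0 gauss0 addr0 mulr_gt0 // lt_neqAle pge andbT eq_sym.
  by apply: contra p0 => /eqP px; rewrite pE q0 px mulr0 addr0.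
apply: ltr_wpDl; first by rewrite mulr_ge0 // ltW.
apply: IH => //; last by rewrite mulf_neq0 // polyXsubC_eq0.
rewrite -ltnS; apply: leq_trans pk; rewrite ltnS.
have X0 : 'X - x0%:P != 0 :> {poly R} by rewrite polyXsubC_eq0.
have sq : size (('X - x0%:P) * ('X - x0%:P) * q) = (size q).+2.
  by rewrite !size_mul ?mulf_neq0 // !size_XsubC.
rewrite pE addrC size_polyDl sq // (leq_ltn_trans (size_polyC_leq1 _)) //.
Qed.

Lemma gauss_ge0 p : (forall x, 0 <= p.[x]) -> 0 <= gauss p.
Proof.
move=> p0; have [->|pn] := eqVneq p 0; first by rewrite gauss0.
by apply: ltW; rewrite -[p]mul1r -[1]mul1r gauss_sqr_mul_gt0 ?oner_eq0.
Qed.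

Lemma gauss_eq0 p : (forall x, 0 <= p.[x]) -> gauss p = 0 -> p = 0.
Proof.
move=> p0 gp; apply/eqP; apply: contraT => pn.
have := gauss_sqr_mul_gt0 (oner_neq0 _) pn p0.
by rewrite !mul1r gp ltxx.
Qed.

End GaussianPositivity.

(** * Gaussian block matrices and weights *)

Section Content.
Variables (n : nat) (B : finType).
Implicit Types i j : {ffun B -> 'I_n}.

(** The weight of a basis tensor under diagonal matrices. The number [weight] is one linear function
    of it, chosen so that it orders the action of upper triangular matrices. *)
Definition content i : {ffun 'I_n -> nat} := [ffun a => #|[pred b | i b == a]|].

Definition weight i : nat := \sum_b i b.

Lemma prod_content (R : comPzSemiRingType) (f : 'I_n -> R) i :
  \prod_b f (i b) = \prod_a f a ^+ content i a.
Proof.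
rewrite (partition_big i predT) //=; apply: eq_bigr => a _.
by rewrite ffunE -prodr_const; apply: eq_bigr => b /eqP ->.
Qed.

Lemma weight_content i : weight i = (\sum_a content i a * a)%N.
Proof.
rewrite /weight (partition_big i predT) //=; apply: eq_bigr => a _.
by rewrite ffunE -sum_nat_const; apply: eq_bigr => b /eqP ->.
Qed.

(** A nonzero product forces [i b <= j b] for every [b]; the inequality between the sums then forces
    equality everywhere. *)
Lemma upper_prod (R : realType) (U : 'M[R]_n) i j : upper U ->
  (weight j <= weight i)%N -> i != j -> \prod_b U (i b) (j b) = 0.
Proof.
move=> uU wji ij; have [/existsP[b bij]|] := boolP [exists b, j b < i b]%N.
  by rewrite (bigD1 b) //= uU ?mul0r.
rewrite negb_exists => /forallP H; case/negP: ij.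
have le b : (i b <= j b ?= iff (i b == j b :> nat))%N.
  by split=> //; have := H b; rewrite -leqNgt.
have [_] := leqif_sum (fun b (_ : true) => le b).
rewrite -/(weight i) -/(weight j) eqn_leq wji andbT.
have -> : (weight i <= weight j)%N by apply: leq_sum => b _; exact: (le b).1.
by move=> /esym /forallP E; apply/eqP/ffunP => b; apply/val_inj/eqP; exact: E.
Qed.

Definition content_part (R : realType) (c : {ffun 'I_n -> nat}) (T : tens R n B) : tens R n B :=
  [ffun i => (content i == c)%:R * T i].

(* An upper triangular matrix can only lower the weight. *)
Lemma upper_lowest (R : realType) (U : 'M[R]_n) (T : tens R n B) i i0 : upper U ->
  T i != 0 -> (forall j, T j != 0 -> (weight i0 <= weight j)%N) ->
  mact U (content_part (content i0) T) i =
  (\prod_a U a a ^+ content i0 a) * content_part (content i0) T i.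
Proof.
move=> uU Ti i0min; rewrite ffunE (bigD1 i) //= [X in _ + X]big1 ?addr0 => [|j ji]; last first.
  rewrite ffunE; have [cj|] := eqVneq (content j) (content i0); last by rewrite mul0r mulr0.
  rewrite upper_prod ?mul0r // 1?eq_sym //.
  by rewrite (weight_content j) cj -weight_content i0min.
rewrite !ffunE; have [ci|] := eqVneq (content i) (content i0); last by rewrite !mul0r !mulr0.
by rewrite (prod_content (fun a => U a a)) ci.
Qed.

End Content.

(** * Moments of families of independent Gaussian variables *)

Section GaussianMatrix.
Variables (R : realType) (X B : finType).
Implicit Types (G : {ffun B -> X} -> R) (A : X -> R) (l : seq X) (s : seq B).

Definition mult s (i : {ffun B -> X}) (x : X) := count (fun b => i b == x) s.

Lemma prod_mult s (i : {ffun B -> X}) A : \prod_(b <- s) A (i b) = \prod_x A x ^+ mult s i x.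
Proof.
elim: s => [|b s IH]; first by rewrite big_nil big1.
rewrite big_cons IH; under [RHS]eq_bigr do rewrite /mult /= exprD.
rewrite big_split /=; congr (_ * _).
rewrite (bigD1 (i b)) //= eqxx expr1 big1 ?mulr1 // => x xb.
by rewrite eq_sym (negPf xb).
Qed.

(** The expectation of the product over [b] in [s] of the variables [i b], for independent standard
    Gaussians indexed by [X]. *)
Definition gauss_mom s (i : {ffun B -> X}) : R := \prod_x gmoment R (mult s i x).

(** The recursive form of Wick's formula: [b] is matched with each [c] of [s] carrying the same
    variable. If there are [N] of them, this is the recursion of [gmoment] at [N.+1]. *)
Lemma gauss_mom_cons b s (i : {ffun B -> X}) : gauss_mom (b :: s) i =
  \sum_(c <- s) (i b == i c)%:R * gauss_mom (rem c s) i.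
Proof.
pose rest := \prod_(x | x != i b) gmoment R (mult s i x).
pose N := mult s i (i b).
have restE s' : (forall x, x != i b -> mult s' i x = mult s i x) ->
    gauss_mom s' i = gmoment R (mult s' i (i b)) * rest.
  move=> Hs; rewrite /gauss_mom (bigD1 (i b)) //=; congr (_ * _).
  by apply: eq_bigr => x xb; rewrite Hs.
rewrite restE => [|x xb]; last by rewrite /mult /= eq_sym (negPf xb).
have -> : mult (b :: s) i (i b) = N.+1 by rewrite /mult /= eqxx.
transitivity (\sum_(c <- s | i c == i b) gmoment R N.-1 * rest); last first.
  rewrite [LHS]big_mkcond; apply: eq_big_seq => c cs.
  rewrite eq_sym; have [cb|_] := eqVneq (i c) (i b); last by rewrite mul0r.
  rewrite mul1r restE => [|x xb]; last first.
    by rewrite /mult count_rem cs cb eq_sym (negPf xb) subn0.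
  by rewrite /mult count_rem cs cb eqxx subn1.
rewrite big_const_seq iter_addr_0 -/(mult s i (i b)) -/N.
case: N => [|N]; first by rewrite mulr0n mul0r.
by rewrite gmomentSS -[RHS]mulr_natl mulrA.
Qed.

(** Partial expectation of the polynomial with coefficients [G]: the variables in [l] are integrated
    out and the others are evaluated at [A]. *)
Definition gauss_part l G A : R := \sum_(i : {ffun B -> X}) G i *
  \prod_x (if x \in l then gmoment R (mult (enum B) i x) else A x ^+ mult (enum B) i x).

(** Variables are integrated one at a time. As a function of the next variable the partial
    expectation is a nonnegative polynomial [q], to which [gauss_ge0] and [gauss_eq0] apply. *)
Lemma gauss_part_ge0 G l : uniq l -> (forall A, 0 <= gauss_part [::] G A) ->
  (forall A, 0 <= gauss_part l G A) /\
  (forall A A', gauss_part l G A = 0 -> (forall x, x \notin l -> A x = A' x) ->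
     gauss_part [::] G A' = 0).
Proof.
move=> + G0; elim: l => [|x l IH] /= => [_|/andP[xl /IH[lge leq]]].
  split=> // A A' <- AA; apply: eq_bigr => i _; congr (_ * _).
  by apply: eq_bigr => x _; rewrite AA.
pose fac l A i z := if z \in l then gmoment R (mult (enum B) i z)
                     else A z ^+ mult (enum B) i z : R.
pose q A : {poly R} := \sum_(i : {ffun B -> X})
  (G i * \prod_(z | z != x) fac l A i z) *: 'X^(mult (enum B) i x).
pose upd A y z : R := if z == x then y else A z.
have qE A y : (q A).[y] = gauss_part l G (upd A y).
  rewrite horner_sum; apply: eq_bigr => i _.
  rewrite hornerZ hornerXn -mulrA; congr (_ * _).
  rewrite [RHS](bigD1 x) //= (negPf xl) {1}/upd eqxx mulrC; congr (_ * _).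
  by apply: eq_bigr => z zx; rewrite /fac /upd (negPf zx).
have gE A : gauss (q A) = gauss_part (x :: l) G A.
  rewrite gauss_sum; apply: eq_bigr => i _.
  rewrite gaussZ gaussXn -mulrA; congr (_ * _).
  rewrite [RHS](bigD1 x) //= mem_head mulrC; congr (_ * _).
  by apply: eq_bigr => z zx; rewrite /fac in_cons (negPf zx).
have qge A y : 0 <= (q A).[y] by rewrite qE.
split=> [A|A A' lA AA]; first by rewrite -gE gauss_ge0.
have q0 : q A = 0 by apply: gauss_eq0 => //; rewrite gE.
apply: (leq (upd A (A' x))); first by rewrite -qE q0 horner0.
move=> z zl; rewrite /upd; have [->//|zx] := eqVneq z x.
by apply: AA; rewrite inE negb_or zx.
Qed.

Lemma gauss_positive G A :
  (forall A', 0 <= \sum_(i : {ffun B -> X}) G i * \prod_b A' (i b)) ->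
  \sum_(i : {ffun B -> X}) G i * gauss_mom (enum B) i = 0 ->
  \sum_(i : {ffun B -> X}) G i * \prod_b A (i b) = 0.
Proof.
have E A' : \sum_(i : {ffun B -> X}) G i * \prod_b A' (i b) = gauss_part [::] G A'.
  apply: eq_bigr => i _; congr (_ * _).
  by rewrite -big_enum prod_mult.
move=> Gge G0; rewrite E.
have [|_ H] := @gauss_part_ge0 G (enum X) (enum_uniq _).
  by move=> A'; rewrite -E.
apply: (H A) => [|x]; last by rewrite mem_enum.
rewrite -[RHS]G0; apply: eq_bigr => i _; congr (_ * _).
by apply: eq_bigr => x _; rewrite mem_enum.
Qed.

End GaussianMatrix.

(** * Invariant tensors *)

Section InvariantTensors.
Variables (R : realType) (n : nat) (B : finType) (bl : 'I_n -> bool).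
Local Notation multi := {ffun B -> 'I_n}.

Definition block_proj (e : bool) : 'M[R]_n :=
  \matrix_(i, j) ((i == j) && (bl i == e))%:R.

(** Consecutive entries of [s] are paired and [es] labels the pairs by blocks. A missing label is
    read as [false], and an entry left alone gives 0. *)
Fixpoint pairing (s : seq B) (es : seq bool) (i : multi) : R :=
  if s is b :: s' then
    if s' is c :: s'' then block_proj (head false es) (i b) (i c) * pairing s'' (behead es) i
    else 0
  else 1.

Definition bpair (i j : multi) : {ffun B -> 'I_n * 'I_n} := [ffun b => (i b, j b)].

Definition block_mask (x : 'I_n * 'I_n) : R := (bl x.1 == bl x.2)%:R.

(** The covariance of two entries of a Gaussian block matrix, split over the blocks into a row
    pairing times a column pairing. *)
Lemma block_pair_sum (i j k l : 'I_n) :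
  ((i, j) == (k, l))%:R * (block_mask (i, j) * block_mask (k, l)) =
  \sum_e block_proj e i k * block_proj e j l :> R.
Proof.
rewrite big_bool !mxE /block_mask xpair_eqE /=.
have [<-|_] := eqVneq i k; last by rewrite !mul0r addr0.
have [<-|_] := eqVneq j l; last by rewrite !mul0r !mulr0 addr0.
by case: (bl i); case: (bl j); rewrite /= ?mul1r ?mulr1 ?mulr0 ?mul0r ?addr0 ?add0r.
Qed.

(* Wick's formula, in dual form: a function orthogonal to all pairings has zero
   contraction with the moments of a Gaussian block matrix. *)
Lemma wick (s : seq B) (w z : multi -> R) :
  (forall s' es, perm_eq s' s -> \sum_i w i * pairing s' es i = 0) ->
  \sum_i \sum_j w i * z j *
    (gauss_mom R s (bpair i j) * \prod_(b <- s) block_mask (i b, j b)) = 0.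
Proof.
have [k] := ubnP (size s); elim: k s w z => // k IH [|b s] w z /= sk wP.
  have := wP [::] [::] isT; under eq_bigr do rewrite mulr1; move=> w0.
  under eq_bigr do under eq_bigr do rewrite big_nil /gauss_mom mulr1 big1 ?mulr1 //.
  by under eq_bigr do rewrite -mulr_sumr; rewrite -mulr_suml w0 mul0r.
(* Match [b] with [c] inside block [e]; the two pairings are absorbed into [w] and [z], and the
   induction applies to [rem c s]. *)
transitivity (\sum_(c <- s) \sum_e \sum_i \sum_j
   (w i * block_proj e (i b) (i c)) * (z j * block_proj e (j b) (j c)) *
   (gauss_mom R (rem c s) (bpair i j) * \prod_(d <- rem c s) block_mask (i d, j d))).
  under [RHS]eq_bigr do (rewrite exchange_big /=;
    under eq_bigr do rewrite exchange_big /=).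
  rewrite [RHS]exchange_big /=; apply: eq_bigr => i _.
  rewrite [RHS]exchange_big /=; apply: eq_bigr => j _.
  rewrite gauss_mom_cons mulr_suml mulr_sumr; apply: eq_big_seq => c cs.
  rewrite big_cons (perm_big _ (perm_to_rem cs)) big_cons /= !ffunE.
  transitivity (w i * z j * (((i b, j b) == (i c, j c))%:R *
      (block_mask (i b, j b) * block_mask (i c, j c))) *
     (gauss_mom R (rem c s) (bpair i j) * \prod_(d <- rem c s) block_mask (i d, j d))).
    by ring.
  rewrite block_pair_sum mulr_sumr mulr_suml; apply: eq_bigr => e _.
  by ring.
rewrite big_seq big1 // => c cs; rewrite big1 // => e _.
apply: IH => [|s' es ss'].
  by rewrite size_rem // (leq_ltn_trans (leq_pred _)).
rewrite -[RHS](wP [:: b, c & s'] (e :: es)); last first.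
  by rewrite perm_cons perm_sym (permPl (perm_to_rem cs)) perm_cons perm_sym.
by apply: eq_bigr => i _; rewrite /= mulrA.
Qed.

Lemma pairing_prod d (b0 : B) (s : seq B) es i : size s = d.*2 ->
  pairing s es i = \prod_(a < d) block_proj (nth false es a)
    (i (nth b0 s a.*2)) (i (nth b0 s a.*2.+1)).
Proof.
elim: d s es => [|d IH] [|b [|c s]] es //=; first by rewrite big_ord0.
move=> [sd]; rewrite big_ord_recl /= nth0 (IH s) //; congr (_ * _).
by apply: eq_bigr => a _; rewrite nth_behead.
Qed.

Lemma pairing_odd (s : seq B) es i : odd (size s) -> pairing s es i = 0.
Proof.
have [k] := ubnP (size s); elim: k s es => // k IH [|b [|c s]] es //= sk.
by rewrite negbK => os; rewrite IH ?mulr0 //; exact: (ltnW sk).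
Qed.

Lemma pairing_ptens (s : seq B) es : perm_eq s (enum B) -> ~~ odd (size s) ->
  exists d (h : 'I_d * bool -> B) (be : 'I_d -> bool), bijective h /\
  forall i, pairing s es i = ptens h (fun a => block_proj (be a)) i.
Proof.
move=> sB es2; set d := (size s)./2.
have sd : size s = d.*2 by rewrite -[LHS]odd_double_half (negPf es2).
have us : uniq s by rewrite (perm_uniq sB) enum_uniq.
have cB : #|B| = d.*2 by rewrite cardE -(perm_size sB).
(* An empty [B] offers no default value for [nth]; then [d = 0] and the empty map is the
   bijection. *)
case: (pickP (fun _ : B => true)) => [b0 _|B0]; last first.
  have d0 : d = 0%N by apply/eqP; rewrite -double_eq0 -cB (eq_card B0) card0.
  have s0 : s = [::] by apply/nilP; rewrite /nilp sd d0.
  have hB : forall x : 'I_d * bool, False by rewrite d0 => -[[]].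
  exists d, (fun x => match hB x with end), (fun=> false); split.
    apply: inj_card_bij => [x|]; first by case: (hB x).
    by rewrite card_prod card_ord card_bool cB muln2.
  move=> i; rewrite s0 /= ffunE big1 // => a _; case: (hB (a, true)).
pose h (x : 'I_d * bool) := nth b0 s (x.2 + x.1.*2).
exists d, h, (fun a => nth false es a); split; last first.
  by move=> i; rewrite (@pairing_prod d b0) // ffunE; apply: eq_bigr => a _; rewrite /h /=.
have hs (x : 'I_d * bool) : (x.2 + x.1.*2 < size s)%N.
  rewrite sd; case: x => -[a ad] [] /=; last by rewrite add0n ltn_double.
  by rewrite add1n ltn_Sdouble.
apply: inj_card_bij; last by rewrite card_prod card_ord card_bool cB muln2.
move=> x y /eqP; rewrite nth_uniq // => /eqP.
case: x y => [a e] [a' e'] /= E.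
have ee : e = e' by have := congr1 odd E; rewrite !oddD !odd_double !addbF !oddb.
by rewrite ee in E *; congr (_, _); apply/val_inj/double_inj/(addnI E).
Qed.

(* First fundamental theorem for the block orthogonal group, in dual form. *)
Lemma invariant_orth_pairings (w : tens R n B) :
  (forall Q : 'M[R]_n, Q *m Q^T = 1%:M -> compat bl Q -> mact Q w = w) ->
  (forall d (h : 'I_d * bool -> B) (be : 'I_d -> bool), bijective h ->
     dot w (ptens h (fun a => block_proj (be a))) = 0) ->
  w = 0.
Proof.
move=> winv wP; apply/eqP; apply: contraT => w0.
have [i1 wi1] : exists i, w i != 0.
  apply/existsP; apply: contraR w0; rewrite negb_exists => /forallP H.
  by apply/eqP/ffunP => i; have := H i; rewrite negbK ffunE => /eqP.
have [i0 wi0 i0min] := @arg_minnP _ i1 (fun i => w i != 0) (@weight n B) wi1.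
pose z := content_part (content i0) w.
(* Changing the sign of coordinate [a] is orthogonal and block diagonal, so it fixes [w]; at [i0] it
   multiplies by the parity sign of [content i0 a]. *)
have even a : ~~ odd (content i0 a).
  pose S : 'M[R]_n := diag_mx (\row_j (-1) ^+ (j == a)).
  have SS : S *m S^T = 1%:M.
    rewrite tr_diag_mx mulmx_diag -diag_const_mx; congr diag_mx.
    by apply/rowP => j; rewrite !mxE -expr2 sqrr_sign.
  have Sc : compat bl S.
    move=> i j ij; rewrite mxE; have [ij'|] := eqVneq i j; last by rewrite mulr0n.
    by rewrite ij' eqxx in ij.
  have := congr1 (fun T : tens R n B => T i0) (winv S SS Sc).
  rewrite ffunE (bigD1 i0) //= [X in _ + X]big1 ?addr0 => [|j ji]; last first.
    have [b ijb] : exists b, i0 b != j b.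
      apply/existsP; apply: contraR ji; rewrite negb_exists => /forallP ij.
      by apply/eqP/ffunP => b; have := ij b; rewrite negbK => /eqP.
    by rewrite (bigD1 b) //= mxE (negPf ijb) mulr0n !mul0r.
  rewrite (prod_content (fun c => S c c)) (bigD1 a) //= [X in _ * X * _]big1; last first.
    by move=> c ca; rewrite !mxE eqxx (negPf ca) expr0 expr1n.
  rewrite !mxE !eqxx expr1 mulr1 => /eqP; rewrite -signr_odd; case: (odd _) => //.
  by rewrite expr1 mulN1r eq_sym -addr_eq0 -mulr2n mulrn_eq0 (negPf wi0).
pose mask (A : 'I_n * 'I_n -> R) : 'M[R]_n := \matrix_(i, j) (block_mask (i, j) * A (i, j)).
(* The coefficients of [dot w (mact (mask A) z)] as a polynomial in the entries of [A]. *)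
pose G (k : {ffun B -> 'I_n * 'I_n}) : R :=
  w [ffun b => (k b).1] * z [ffun b => (k b).2] * \prod_b block_mask (k b).
have sumG (F : {ffun B -> 'I_n * 'I_n} -> R) : \sum_k G k * F k =
   \sum_i \sum_j w i * z j * (F (bpair i j) * \prod_b block_mask (i b, j b)).
  rewrite pair_bigA /=.
  rewrite (reindex (fun p : multi * multi => bpair p.1 p.2)) /=; last first.
    exists (fun k => ([ffun b => (k b).1], [ffun b => (k b).2])) => [[i j] _|k _].
      by congr (_, _); apply/ffunP => b; rewrite !ffunE.
    by apply/ffunP => b; rewrite !ffunE; case: (k b).
  apply: eq_bigr => -[i j] _; rewrite /G /= -!mulrA; congr (_ * _).
    by congr (w _); apply/ffunP => b; rewrite !ffunE.
  congr (_ * _).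
    by congr (z _); apply/ffunP => b; rewrite !ffunE.
  by rewrite mulrC; congr (_ * _); apply: eq_bigr => b _; rewrite ffunE.
have GA A : \sum_k G k * \prod_b A (k b) = dot w (mact (mask A) z).
  rewrite sumG /dot; apply: eq_bigr => i _; rewrite [mact _ _ _]ffunE mulr_sumr.
  apply: eq_bigr => j _; rewrite -big_split /= mulrAC -mulrA; congr (_ * (_ * _)).
  by apply: eq_bigr => b _; rewrite mxE ffunE mulrC.
have zz : dot w z = dot z z.
  apply: eq_bigr => i _; rewrite !ffunE; case: eqP => _; last by rewrite !mul0r !mulr0.
  by rewrite !mul1r.
(* Since [w] is invariant, [mask A] may be replaced by its upper triangular factor, which acts on
   the lowest part [z] by a product of even powers. *)
have posG A : 0 <= \sum_k G k * \prod_b A (k b).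
  have cA : compat bl (mask A).
    by move=> i j ij; rewrite mxE /block_mask (negPf ij) mul0r.
  have [Q [QQ cQ uQ]] := qr_compat cA.
  have QQ' : Q^T *m Q = 1%:M by apply: mulmx1C.
  rewrite GA -[mask A]mul1mx -QQ' -mulmxA -mactM -mact_dot winv //.
  have -> : dot w (mact (Q *m mask A) z) =
      (\prod_a (Q *m mask A) a a ^+ content i0 a) * dot w z.
    rewrite /dot mulr_sumr; apply: eq_bigr => i _.
    have [->|wi] := eqVneq (w i) 0; first by rewrite !mul0r mulr0.
    by rewrite upper_lowest // mulrCA.
  rewrite zz mulr_ge0 ?dot_ge0 // prodr_ge0 // => a _.
  by rewrite exprn_even_ge0.
(* The nonnegative polynomial has expectation 0 by [wick], so it vanishes at the identity matrix,
   where it equals [dot z z]. *)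
have z0 : dot z z = 0.
  have maskI : mask (fun x => (x.1 == x.2)%:R) = 1%:M.
    apply/matrixP => i j; rewrite !mxE /block_mask /=.
    by have [->|_] := eqVneq i j; rewrite ?eqxx ?mulr1 ?mulr0.
  rewrite -zz -[z]mact1 -maskI -GA.
  rewrite (@gauss_positive _ _ _ G (fun x => (x.1 == x.2)%:R)) // sumG.
  under eq_bigr do under eq_bigr do rewrite -[\prod_b _]big_enum.
  apply: (@wick (enum B) w z) => s es sB.
  have [os|/pairing_ptens] := boolP (odd (size s)).
    by rewrite big1 // => i _; rewrite pairing_odd ?mulr0.
  move=> /(_ es sB)[d [h [be [hbij H]]]].
  by rewrite -[RHS](wP d h be hbij); apply: eq_bigr => i _; rewrite H.
have := congr1 (fun T : tens R n B => T i0) (dot_eq0 z0).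
by rewrite !ffunE eqxx mul1r => /eqP; rewrite (negPf wi0).
Qed.

End InvariantTensors.

(** * Trace-free tensors *)

Section Tracefree.
Variables (R : realType) (n : nat) (B : finType).
Local Notation multi := {ffun B -> 'I_n}.
Implicit Types (b c : B) (i : multi) (a : 'I_n) (T : tens R n B).

Definition upd b c i a : multi := [ffun x => if (x == b) || (x == c) then a else i x].

Definition tracefree T := forall b c i, b != c -> \sum_(a < n) T (upd b c i a) = 0.

Definition insertion b c i : tens R n B := \sum_(a < n) basis_vec R (upd b c i a).

Lemma dot_insertion T b c i : dot T (insertion b c i) = \sum_(a < n) T (upd b c i a).
Proof. by rewrite dot_sumr; apply: eq_bigr => a _; rewrite dot_basis. Qed.

Lemma tracefree_lin : lin_closed tracefree.
Proof.
split=> [b c i _|a S T HS HT b c i bc].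
  by apply: big1 => a _; rewrite ffunE.
under eq_bigr do rewrite !ffunE.
by rewrite big_split /= -scaler_sumr HS // HT // scaler0 addr0.
Qed.

Lemma tracefree_reidx (s : {perm B}) T : tracefree T -> tracefree (reidx s T).
Proof.
move=> HT b c i bc.
rewrite -[RHS](HT (s^-1%g b) (s^-1%g c) [ffun x => i (s x)]); last first.
  by rewrite (inj_eq perm_inj).
apply: eq_bigr => a _; rewrite ffunE; congr (T _); apply/ffunP => x; rewrite !ffunE.
by rewrite !(can2_eq (permK s) (permKV s)).
Qed.

(** Group the indices by their letters away from [b] and [c]: [phi] is constant on each group, and
    what remains is a trace of [T]. *)
Lemma tracefree_sum T b c (phi : multi -> R) : tracefree T -> b != c ->
  (forall i a, phi (upd b c i a) = phi i) ->
  \sum_(i : multi) (i b == i c)%:R * phi i * T i = 0.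
Proof.
move=> HT bc phiE.
case: (pickP (fun i : multi => true)) => [i1 _|i0]; last first.
  by rewrite big1 // => i _; have := i0 i.
(* [o] is an arbitrary letter. An index with equal letters at [b] and [c] is encoded by this common
   letter and by the index with [o] written at both places. *)
pose o := i1 b.
transitivity (\sum_(i : multi) \sum_(a < n)
    ((i b == o) && (i c == o))%:R * phi i * T (upd b c i a)); last first.
  by rewrite big1 // => i _; rewrite -mulr_sumr HT // mulr0.
rewrite pair_bigA /= [LHS]big_mkcond [RHS]big_mkcond /=.
transitivity (\sum_(i : multi | i b == i c) phi i * T i).
  rewrite [RHS]big_mkcond; apply: eq_bigr => i _.
  by case: eqP; rewrite ?mul1r // !mul0r.
transitivity (\sum_(p : multi * 'I_n | (p.1 b == o) && (p.1 c == o))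
   phi p.1 * T (upd b c p.1 p.2)); last first.
  rewrite [LHS]big_mkcond; apply: eq_bigr => p _.
  by case: ifP; rewrite ?mul1r // !mul0r.
rewrite [RHS](reindex_onto (fun i : multi => (upd b c i o, i b))
   (fun p => upd b c p.1 p.2)) /=; last first.
  move=> [i a] /= /andP[/eqP ib /eqP ic]; congr (_, _); last by rewrite ffunE eqxx.
  apply/ffunP => x; rewrite !ffunE; have [->|_] := eqVneq x b; first by rewrite ib.
  by have [->|_] := eqVneq x c; first by rewrite ic.
have updE i : upd b c (upd b c i o) (i b) = upd b c i (i b).
  by apply/ffunP => x; rewrite !ffunE; case: ((x == b) || (x == c)).
apply: eq_big => [i|i /eqP ibc]; last first.
  rewrite phiE updE; congr (_ * T _); apply/ffunP => x; rewrite !ffunE.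
  by have [->|_] := eqVneq x b; [|have [->|_] := eqVneq x c; rewrite ?ibc].
rewrite !ffunE !eqxx orbT /= updE eqxx /=; apply/eqP/eqP => [ibc|E].
  apply/ffunP => x; rewrite !ffunE.
  by have [->|_] := eqVneq x b; [|have [->|_] := eqVneq x c; rewrite ?ibc].
by rewrite -[in RHS]E ffunE eqxx orbT.
Qed.

(** Because [Q^T Q = 1], a trace of [mact Q T] over [b] and [c] is a trace of [T] weighted by the
    entries of [Q] at the other factors. *)
Lemma tracefree_mact (Q : 'M[R]_n) T : Q^T *m Q = 1%:M ->
  tracefree T -> tracefree (mact Q T).
Proof.
move=> QQ HT b c i bc; rewrite -dot_insertion mact_dot.
pose phi (j : multi) := \prod_(x | (x != b) && (x != c)) Q (i x) (j x).
rewrite -[RHS](@tracefree_sum T b c phi) // => [|j a]; last first.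
  apply: eq_bigr => x /andP[xb xc].
  by rewrite ffunE (negPf xb) (negPf xc).
apply: eq_bigr => j _; rewrite mulrC; congr (_ * _).
rewrite [LHS]ffunE /insertion.
under eq_bigr do rewrite sum_ffunE mulr_sumr.
rewrite exchange_big /=.
transitivity (\sum_(a < n) Q a (j b) * Q a (j c) * phi j); last first.
  rewrite -mulr_suml; congr (_ * _); have /matrixP /(_ (j b) (j c)) := QQ.
  by rewrite !mxE => <-; apply: eq_bigr => a _; rewrite mxE.
apply: eq_bigr => a _; rewrite (bigD1 (upd b c i a)) //= [X in _ + X]big1 ?addr0; last first.
  by move=> k /negPf ka; rewrite ffunE ka mulr0.
rewrite ffunE eqxx mulr1 (bigD1 b) // (bigD1 c) 1?eq_sym //= mulrA.
rewrite !mxE !ffunE !eqxx orbT; congr (_ * _).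
by apply: eq_bigr => x /andP[xb xc]; rewrite mxE ffunE (negPf xb) (negPf xc).
Qed.

End Tracefree.

(** [d] is the product of its restriction to [E] and of the conjugate of that restriction by [tau],
    two permutations of the same sign. *)
Lemma even_split_perm (T : finType) (E : {set T}) (d tau : {perm T}) :
  (forall x, (d x \in E) = (x \in E)) -> (forall x, (tau x \in E) = (x \notin E)) ->
  (forall x, d (tau x) = tau (d x)) -> odd_perm d = false.
Proof.
move=> dE tE dt.
have dN : d \in 'N(E | 'P)%g.
  apply/astabsP => x; rewrite /= apermE; exact: dE.
pose d1 := restr_perm E d.
have d1E x : x \in E -> d1 x = d x by move=> xE; rewrite restr_permE.
have d1N x : x \notin E -> d1 x = x by move=> xE; rewrite (out_perm (restr_perm_on E d)).
have -> : d = (d1 * (d1 ^ tau))%g.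
  apply/permP => x; rewrite permM conjgE !permM.
  have tI y : (tau^-1%g y \in E) = (y \notin E) by rewrite -[y in RHS](permKV tau) tE negbK.
  have [xE|xE] := boolP (x \in E).
    by rewrite (d1E x) // (d1N (tau^-1%g (d x))) ?permKV // tI dE xE.
  by rewrite (d1N x) // d1E ?tI // -dt permKV.
by rewrite odd_permM odd_permJ addbb.
Qed.

(** * Weyl modules *)

Lemma reidxP (R : realType) (n : nat) (B C : finType) (h : C -> B) a (S T : tens R n C) :
  reidx h (a *: S + T) = a *: reidx h S + reidx h T.
Proof. by apply/ffunP => i; rewrite !ffunE. Qed.

Section Weyl.
Variables (R : realType) (m n : nat) (lam : 'I_m -> nat).
Local Notation box := (box lam).
Implicit Types (T : tens R n box).

Lemma young_symmetrizerP a S T : young_symmetrizer (a *: S + T : tensor R n lam) =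
  a *: young_symmetrizer S + young_symmetrizer T.
Proof.
rewrite /young_symmetrizer scaler_sumr -big_split; apply: eq_bigr => c _.
rewrite scaler_sumr -big_split; apply: eq_bigr => r _.
rewrite -![tperm_act _ _]/(reidx _ _) !reidxP.
by rewrite scalerDr !scalerA mulrC.
Qed.

Lemma mact_sum (g : 'M[R]_n) (J : Type) (r : seq J) (P : pred J) (F : J -> tens R n box) :
  mact g (\sum_(j <- r | P j) F j) = \sum_(j <- r | P j) mact g (F j).
Proof.
have m0 : mact g 0 = 0 :> tens R n box.
  by have := mactB g 0 (0 : tens R n box); rewrite !subrr.
elim/big_rec2: _ => [//|j u v _ <-].
by rewrite -[F j in LHS]scale1r mactP scale1r.
Qed.

Lemma young_mact (g : 'M[R]_n) T :
  mact g (young_symmetrizer T) = young_symmetrizer (mact g T) :> tens R n box.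
Proof.
rewrite mact_sum; apply: eq_bigr => c _; rewrite mact_sum; apply: eq_bigr => r _.
rewrite -![tperm_act _ _]/(reidx _ _).
have bij (s : {perm box}) : bijective s by exists (s^-1)%g; [exact: permK|exact: permKV].
have mZ a (S : tens R n box) : mact g (a *: S) = a *: mact g S.
  have := mactP g a S 0; rewrite !addr0.
  have -> : mact g 0 = 0 :> tens R n box.
    by have := mactB g 0 (0 : tens R n box); rewrite !subrr.
  by rewrite addr0.
by rewrite mZ !reidx_mact.
Qed.

Lemma young_tracefree T : tracefree T -> tracefree (young_symmetrizer T : tens R n box).
Proof.
move=> HT; apply: (lin_closed_sum (tracefree_lin R n box)) => c _.
apply: (lin_closed_sum (tracefree_lin R n box)) => r _.
apply: (lin_closedZ (tracefree_lin R n box)).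
exact/tracefree_reidx/tracefree_reidx.
Qed.

Lemma weyl_lin : lin_closed (weyl_module (R := R) (n := n) (lam := lam)).
Proof.
split=> [|a S T [S0 [S' SE]] [T0 [T' TE]]].
  split; first exact: (tracefree_lin R n box).1.
  exists (0 : tens R n box).
  have E : (-1) *: 0 + 0 = 0 :> tensor R n lam by rewrite scaler0 addr0.
  by have := young_symmetrizerP (-1) 0 0; rewrite E scaleN1r addNr.
split; first exact: ((tracefree_lin R n box).2 a _ _ S0 T0).
by exists (a *: S' + T' : tens R n box); rewrite young_symmetrizerP SE TE.
Qed.

Lemma orthogonal_trmul (g : Defs.orthogonal R n) : g^T *m g = 1%:M.
Proof. by apply: mulmx1C; exact: orth_mxP. Qed.

Lemma weyl_mact (g : Defs.orthogonal R n) T : weyl_module T -> weyl_module (mact g T).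
Proof.
move=> [T0 [S SE]]; split.
  by apply: tracefree_mact => //; exact: orthogonal_trmul.
by exists (mact g S : tens R n box); rewrite SE; exact: young_mact.
Qed.

Lemma weyl_young T : tracefree T -> weyl_module (young_symmetrizer T).
Proof. by move=> HT; split; [exact: young_tracefree|exists T]. Qed.

Lemma box_ext (b c : box) : box_row b = box_row c -> box_col b = box_col c -> b = c.
Proof.
case: b c => [i j] [i' j']; rewrite /box_row /box_col /= => ii; subst i'.
by move=> /val_inj ->.
Qed.

Hypothesis mn : (m <= n)%N.
(** The filling whose row [r] contains only the letter [r]; its basis tensor yields the highest
    weight vector of the Young symmetrizer. *)
Definition highest_index : {ffun box -> 'I_n} := [ffun b => widen_ord mn (box_row b)].
Local Notation rho := highest_index.

Hypothesis lam_dec : forall i j : 'I_m, (i <= j)%N -> (lam j <= lam i)%N.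

(** Induction on rows: if [j b] is less than the row of [b], the box of the same column in row [j b]
    already carries the letter [j b], against injectivity on columns. That box exists because [lam]
    is decreasing. *)
Lemma highest_index_uniq (j : {ffun box -> 'I_n}) : (forall b, j b <= rho b)%N ->
  (forall b c, box_col b = box_col c -> j b = j c -> b = c) -> j = rho.
Proof.
move=> jr jinj; apply/ffunP => b; apply/val_inj.
have [k] := ubnP (box_row b); elim: k b => // k IH b bk.
apply/eqP; rewrite eqn_leq jr /= leqNgt; apply/negP => jlt.
have jm : (j b < m)%N.
  by apply: ltn_trans jlt _; rewrite ffunE /= ltn_ord.
have jrow : (Ordinal jm < box_row b)%N by move: jlt; rewrite ffunE.
have colb : (box_col b < lam (Ordinal jm))%N.
  by apply: leq_trans (lam_dec (ltnW jrow)); exact: ltn_ord.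
pose c : box := Tagged (fun i => 'I_(lam i)) (Ordinal colb).
have jc : j c = j b.
  apply/val_inj; rewrite [LHS]IH; first by rewrite ffunE.
  by apply: leq_trans jrow _; rewrite -ltnS.
have cb : c = b by apply: jinj.
have /= E := congr1 (fun x : box => nat_of_ord (box_row x)) cb.
by move: jrow; rewrite -E /= ltnn.
Qed.

(** Composition with the transposition of [b] and [c] pairs off the terms with opposite signs. *)
Lemma col_antisym (j : {ffun box -> 'I_n}) (b c : box) (i : {ffun box -> 'I_n}) :
  b != c -> box_col b = box_col c -> j b = j c ->
  \sum_(s in col_stab lam) (-1) ^+ odd_perm s * ([ffun x => i (s x)] == j)%:R = 0 :> R.
Proof.
move=> bc colbc jbc; set S := LHS.
suff /eqP : S = - S by rewrite -addr_eq0 -mulr2n mulrn_eq0 => /eqP.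
have colt x : box_col (tperm b c x) = box_col x.
  by case: tpermP => // ->.
rewrite /S -sumrN (reindex_inj (mulgI (tperm b c))) /=.
apply: eq_big => [s|s _].
  rewrite !inE; apply/forallP/forallP => H x; last by rewrite permM (eqP (H _)) colt.
  by have := H (tperm b c x); rewrite permM tpermK colt.
rewrite odd_permM odd_tperm bc signr_addb expr1 mulN1r mulNr; congr (- (_ * _%:R)).
have jt x : j (tperm b c x) = j x by case: tpermP => // ->.
congr (nat_of_bool _); apply/eqP/eqP => E; apply/ffunP => x.
  by have := congr1 (fun f : {ffun box -> 'I_n} => f (tperm b c x)) E;
    rewrite !ffunE permM tpermK jt.
by rewrite ffunE permM -jt -E ffunE.
Qed.

(** [rho] is constant on rows, so row symmetrization preserves the condition on the support. By
    [highest_index_uniq] each remaining filling repeats a letter in some column, and column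
    antisymmetrization kills it. *)
Lemma young_below T : (forall i, T i != 0 -> (forall b, i b <= rho b)%N /\ i != rho) ->
  young_symmetrizer T = 0 :> tens R n box.
Proof.
move=> HT.
pose T2 : tens R n box := \sum_(r in row_stab lam) reidx r T.
have T2E i : T2 i = \sum_(r in row_stab lam) T [ffun b => i (r b)].
  by rewrite sum_ffunE; apply: eq_bigr => r _; rewrite ffunE.
have HT2 j : T2 j != 0 -> exists b c : box, [/\ b != c, box_col b = box_col c & j b = j c].
  rewrite T2E => jn0.
  have [r rs Tr] : exists2 r, r \in row_stab lam & T [ffun b => j (r b)] != 0.
    apply/exists_inP; apply: contraR jn0; rewrite negb_exists_in => /forall_inP H.
    by rewrite big1 // => r /H; rewrite negbK => /eqP.
  have rr b : rho (r b) = rho b.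
    by move: rs; rewrite inE => /forallP/(_ b)/eqP E; rewrite !ffunE E.
  have [le ne] := HT _ Tr.
  have jle b : (j b <= rho b)%N.
    by have := le (r^-1%g b); rewrite ffunE permKV -rr permKV.
  have jne : j != rho.
    by apply: contra ne => /eqP ->; apply/eqP/ffunP => b; rewrite ffunE rr.
  apply: contrapT => H; case/negP: jne; apply/eqP.
  apply: highest_index_uniq => // b c col jbc; apply/eqP; apply: contraT => bc.
  by case: H; exists b, c.
apply/ffunP => i; rewrite /young_symmetrizer sum_ffunE [RHS]ffunE.
transitivity (\sum_(c in col_stab lam) \sum_j
    T2 j * ((-1) ^+ odd_perm c * ([ffun x => i (c x)] == j)%:R)).
  apply: eq_bigr => c _; rewrite (bigD1 [ffun x => i (c x)]) //=.
  rewrite [X in _ = _ + X]big1 => [|j /negPf jc].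
    rewrite eqxx mulr1 addr0 T2E sum_ffunE mulr_suml; apply: eq_bigr => r _.
    rewrite !ffunE mulrC; congr (_ * T _).
  by rewrite eq_sym jc !mulr0.
rewrite exchange_big big1 // => j _.
have [->|/HT2[b [c [bc colbc jbc]]]] := eqVneq (T2 j) 0.
  by rewrite big1 // => c _; rewrite mul0r.
by rewrite -mulr_sumr (col_antisym i bc colbc jbc) mulr0.
Qed.

Lemma young_upper (U : 'M[R]_n) : upper U ->
  young_symmetrizer (mact U (basis_vec R rho)) =
  (\prod_a U a a ^+ content rho a) *: young_symmetrizer (basis_vec R rho) :> tens R n box.
Proof.
move=> uU; set e := basis_vec R rho; set p := \prod_a _.
apply/eqP; rewrite -subr_eq0 addrC -scaleNr; apply/eqP.
have UE i : mact U e i = \prod_b U (i b) (rho b).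
  rewrite ffunE (bigD1 rho) //= [X in _ + X]big1 ?addr0 => [|j /negPf jr]; last by rewrite ffunE jr mulr0.
  by rewrite ffunE eqxx mulr1.
rewrite -[X in X + _]/((- p) *: (young_symmetrizer e : tensor R n lam)).
rewrite -young_symmetrizerP; apply: young_below => i.
rewrite ffunE UE ffunE ffunE.
have [->|ir] := eqVneq i rho.
  by rewrite (prod_content (fun a => U a a)) -/p /GRing.scale /= mulr1 addNr eqxx.
rewrite scaler0 add0r => n0; split=> // b; rewrite leqNgt.
by apply: contra n0 => lt; rewrite (bigD1 b) //= uU ?mul0r.
Qed.

(** [h] cuts the diagram into horizontal dominoes. No term of the expansion is negative, and the
    identity contributes a positive one. *)
Lemma young_highest_pairing (A : finType) (h : A * bool -> box) (k : A -> nat) :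
  bijective h -> (forall a, box_row (h (a, true)) = box_row (h (a, false))) ->
  (forall a e, box_col (h (a, e)) = (e + (k a).*2)%N) ->
  0 < dot (young_symmetrizer (basis_vec R rho) : tens R n box) (ptens h (fun=> 1%:M)).
Proof.
move=> [h' hK h'K] hrow hcol; set P := ptens h _.
have oddcol a e : odd (box_col (h (a, e))) = e.
  by rewrite hcol oddD odd_double addbF oddb.
have reidx_basis (s : {perm box}) (i : {ffun box -> 'I_n}) :
    reidx s (basis_vec R i) = basis_vec R [ffun b => i (s^-1%g b)].
  apply/ffunP => j; rewrite !ffunE; congr (nat_of_bool _)%:R.
  apply/eqP/eqP => [<-|->]; apply/ffunP => b; rewrite !ffunE ?permKV ?permK //.
have rowfix (r : {perm box}) : r \in row_stab lam -> reidx r (basis_vec R rho) = basis_vec R rho.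
  rewrite inE => /forallP H; rewrite reidx_basis; congr basis_vec.
  apply/ffunP => b; rewrite !ffunE; congr widen_ord.
  by have /eqP := H (r^-1%g b); rewrite permKV.
have PE i : P i = (\prod_a (i (h (a, false)) == i (h (a, true))))%:R.
  rewrite ffunE natr_prod; apply: eq_bigr => a _.
  by rewrite mxE; case: eqP.
(* In a nonzero term the inverse [d] of [c] sends the two halves of a domino into one row. It
   preserves columns, so it commutes with the exchange [tau] of the halves and is even. *)
have sgn (c : {perm box}) : c \in col_stab lam ->
    0 <= (-1) ^+ odd_perm c * P [ffun b => rho (c^-1%g b)].
  move=> cs; rewrite PE; set q := \prod_a _.
  have [->|q0] := eqVneq q 0%N; first by rewrite mulr0.
  suff -> : odd_perm c = false by rewrite expr0 mul1r ler0n.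
  pose d := (c^-1)%g.
  have drow a : box_row (d (h (a, true))) = box_row (d (h (a, false))).
    have : [ffun b => rho (d b)] (h (a, false)) == [ffun b => rho (d b)] (h (a, true)).
      by apply: contraTT q0 => /negPf E; rewrite negbK /q (bigD1 a) //= E.
    by rewrite !ffunE => /eqP/(congr1 val)/= /val_inj.
  have dcol x : box_col (d x) = box_col x.
    by move: cs; rewrite inE => /forallP/(_ (d x))/eqP; rewrite permKV.
  have tinj : injective (fun x => h ((h' x).1, ~~ (h' x).2)).
    move=> x y /(can_inj hK)[E1 /negb_inj E2].
    by rewrite -(h'K x) -(h'K y) (surjective_pairing (h' x)) E1 E2 -surjective_pairing.
  pose tau := perm tinj.
  have tauE a e : tau (h (a, e)) = h (a, ~~ e) by rewrite permE hK.
  rewrite -odd_permV -/d.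
  apply: (@even_split_perm _ [set b | ~~ odd (box_col b)] d tau) => x.
  - by rewrite !inE dcol.
  - by rewrite -(h'K x); case: (h' x) => a e; rewrite tauE !inE !oddcol.
  rewrite -(h'K x); case: (h' x) => a e; rewrite tauE.
  have := dcol (h (a, e)); have : box_row (d (h (a, ~~ e))) = box_row (d (h (a, e))).
    by case: e; rewrite drow.
  rewrite -(h'K (d (h (a, e)))); case: (h' _) => a' e' row col.
  have ee : e' = e by have := congr1 odd col; rewrite !oddcol.
  rewrite ee in row col *; rewrite tauE; apply: box_ext.
    by rewrite row; case: e {ee col row} => /=; rewrite hrow.
  by rewrite dcol !hcol; move: col; rewrite !hcol => /addnI/double_inj ->.
have one : 1%g \in col_stab lam by rewrite inE; apply/forallP => b; rewrite perm1.
have one' : 1%g \in row_stab lam by rewrite inE; apply/forallP => b; rewrite perm1.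
have E : dot (young_symmetrizer (basis_vec R rho) : tens R n box) P =
    #|row_stab lam|%:R * \sum_(c in col_stab lam) (-1) ^+ odd_perm c * P [ffun b => rho (c^-1%g b)].
  rewrite dotC dot_sumr mulr_sumr; apply: eq_bigr => c _; rewrite dot_sumr.
  rewrite mulr_natl -sumr_const; apply: eq_bigr => r rs.
  by rewrite dotZr -![tperm_act _ _]/(reidx _ _) rowfix // reidx_basis dot_basis.
rewrite E mulr_gt0 //.
  by rewrite ltr0n; apply/card_gt0P; exists 1%g.
rewrite (bigD1 1%g) //= ltr_pwDl ?sumr_ge0 // => [|c /andP[cs _]]; last exact: sgn.
rewrite odd_perm1 expr0 mul1r PE big1 ?ltr01 // => a _.
by rewrite !ffunE invg1 !perm1 hrow eqxx.
Qed.

End Weyl.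

(** * Projections and polynomial functions on the Grassmannian *)

Section ProjectionGeometry.
Variables (R : realType) (n : nat).
Implicit Types (U : {vspace 'rV[R]_n}) (g : 'M[R]_n).

Lemma orth_proj_uniq U (P : 'M[R]_n) : P^T = P ->
  (forall v, v \in U -> v *m P = v) -> (forall v, v *m P \in U) -> orth_proj U = P.
Proof.
move=> PT fixP memP.
have PQ : P *m orth_proj U = P.
  by apply/row_matrixP => i; rewrite row_mul orth_proj_fix // rowE.
have QP : orth_proj U *m P = orth_proj U.
  by apply/row_matrixP => i; rewrite row_mul fixP // rowE orth_proj_mem.
by rewrite -[LHS]orth_proj_sym -QP trmx_mul PT orth_proj_sym PQ.
Qed.

Lemma orth_proj_idem U : orth_proj U *m orth_proj U = orth_proj U.
Proof.
by apply/row_matrixP => i; rewrite row_mul orth_proj_fix // rowE orth_proj_mem.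
Qed.

Lemma orth_proj_symE U i j : orth_proj U i j = orth_proj U j i.
Proof. by rewrite -{1}orth_proj_sym mxE. Qed.

Lemma orth_proj_tr U : \tr (orth_proj U) = (\dim U)%:R.
Proof.
rewrite /orth_proj -mulmxA mxtrace_mulC -mulmxA mulVmx ?gram_unit //.
by rewrite mxtrace1.
Qed.

Lemma orth_proj_rank U : (\rank (orth_proj U) <= \dim U)%N.
Proof. by rewrite /orth_proj (leq_trans (mxrankM_maxr _ _)) // rank_leq_row. Qed.

Lemma orth_proj_inj U V : orth_proj U = orth_proj V -> U = V.
Proof.
move=> UV; apply/vspaceP => v; apply/idP/idP => vin.
  by rewrite -(orth_proj_fix vin) UV orth_proj_mem.
by rewrite -(orth_proj_fix vin) -UV orth_proj_mem.
Qed.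

Lemma orth_proj_rot (g : Defs.orthogonal R n) U :
  orth_proj (Defs.rot g @: U)%VS = g *m orth_proj U *m g^T.
Proof.
apply: orth_proj_uniq.
- by rewrite trmx_mul trmxK (trmx_mul (orth_mx g)) orth_proj_sym mulmxA.
- move=> _ /memv_imgP[u uU ->]; rewrite rotE mulmxA [u *m _ *m (g *m _)]mulmxA -[u *m _ *m g]mulmxA.
  by rewrite orthogonal_trmul mulmx1 orth_proj_fix.
- by move=> v; rewrite mulmxA -rotE memv_img // mulmxA orth_proj_mem.
Qed.

Lemma mxtr_sym_eq0 (X : 'M[R]_n) : X^T = X -> \tr (X *m X) = 0 -> X = 0.
Proof.
move=> XT /eqP; rewrite /mxtrace psumr_eq0 => [/allP H|i _]; last first.
  by rewrite mxE sumr_ge0 // => j _; rewrite -{2}XT mxE -expr2 sqr_ge0.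
apply/matrixP => i j; rewrite [RHS]mxE.
have := H i; rewrite mem_index_enum mxE psumr_eq0 => [/(_ isT)/allP/(_ j)|k _]; last first.
  by rewrite -{2}XT mxE -expr2 sqr_ge0.
by rewrite mem_index_enum -{2}XT mxE -expr2 sqrf_eq0 => /(_ isT)/eqP.
Qed.

Definition first_coords (m : nat) (i : 'I_n) : bool := (i < m)%N.

Lemma block_proj_tr m : (m <= n)%N -> \tr (block_proj R (first_coords m) true) = m%:R.
Proof.
move=> mn; rewrite /mxtrace; under eq_bigr do rewrite mxE eqxx /= eqb_id.
rewrite -natr_sum -[in RHS](card_ord m) -sum1_card; congr _%:R.
rewrite (big_ord_widen n (fun=> 1%N) mn) [RHS]big_mkcond /=.
by apply: eq_bigr => i _; rewrite /first_coords; case: (i < m)%N.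
Qed.

Lemma block_projC (bl : 'I_n -> bool) : block_proj R bl false = 1%:M - block_proj R bl true.
Proof.
apply/matrixP => i j; rewrite !mxE.
by have [_|_] := eqVneq i j; case: (bl i); rewrite /= ?subr0 ?subrr.
Qed.

Lemma block_proj_id (bl : 'I_n -> bool) :
  block_proj R bl true *m block_proj R bl true = block_proj R bl true.
Proof.
apply/matrixP => i j; rewrite mxE (bigD1 i) //= big1 ?addr0 => [|k /negPf ki].
  by rewrite !mxE eqxx; case: (bl i); rewrite ?mul1r ?mul0r ?andbF.
by rewrite !mxE eq_sym ki mul0r.
Qed.

Lemma block_proj_sym (bl : 'I_n -> bool) e : (block_proj R bl e)^T = block_proj R bl e.
Proof.
by apply/matrixP => i j; rewrite !mxE; have [->|_] := eqVneq j i; rewrite // eq_sym.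
Qed.

Lemma compat_block_proj (bl : 'I_n -> bool) (Q : 'M[R]_n) : compat bl Q ->
  Q *m block_proj R bl true = block_proj R bl true *m Q.
Proof.
move=> cQ; apply/matrixP => i j; rewrite !mxE.
rewrite (bigD1 j) //= [X in _ + X]big1 ?addr0 => [|k /negPf kj]; last by rewrite mxE kj mulr0.
rewrite [RHS](bigD1 i) //= [X in _ = _ + X]big1 ?addr0 => [|k /negPf ki]; last first.
  by rewrite mxE eq_sym ki mul0r.
rewrite !mxE !eqxx /=; have [->|/cQ ->] := eqVneq (bl i) (bl j); first by rewrite mulrC.
by rewrite mul0r mulr0.
Qed.

Lemma orth_proj_base U : (\dim U <= n)%N ->
  exists2 g : 'M[R]_n, g *m g^T = 1%:M &
    orth_proj U = g *m block_proj R (first_coords (\dim U)) true *m g^T.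
Proof.
move=> dn; set P0 := block_proj _ _ _; set Bm := basis_mx U.
(* A basis of [U] in the first columns, padded by zero columns. Triangularity after [Q] moves [U]
   into the first coordinates. *)
pose A : 'M[R]_n := \matrix_(i, j)
  if (insub (j : nat) : option 'I_(\dim U)) is Some j' then Bm j' i else 0.
have [Q [QQ uQ]] := qr A.
have QQ' : Q^T *m Q = 1%:M by exact: mulmx1C.
have BQ (j : 'I_(\dim U)) (i : 'I_n) : (\dim U <= i)%N -> (Bm *m Q^T) j i = 0.
  move=> di; rewrite -(uQ i (widen_ord dn j)); last by rewrite (leq_trans _ di) /=.
  rewrite !mxE; apply: eq_bigr => k _; rewrite !mxE mulrC; congr (_ * _).
  case: insubP => [j' _ jj'|/negP[]]; last exact: (ltn_ord j).
  have jj : j' = j by exact/val_inj.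
  by rewrite jj /Bm /basis_mx mxE.
have BQP : Bm *m Q^T *m P0 = Bm *m Q^T.
  apply/matrixP => j i; rewrite [LHS]mxE (bigD1 i) //= big1 ?addr0 => [|k /negPf ki].
    rewrite [P0 _ _]mxE eqxx eqb_id /first_coords /=.
    by case: ltnP => di; rewrite ?mulr1 // BQ // mul0r.
  by rewrite [P0 _ _]mxE ki mulr0.
set P := orth_proj U.
pose P1 := Q *m P *m Q^T.
have PT : P^T = P by exact: orth_proj_sym.
have PP : P *m P = P by exact: orth_proj_idem.
have trP : \tr P = (\dim U)%:R by exact: orth_proj_tr.
have P10 : P1 *m P0 = P1.
  by rewrite /P1 /P /orth_proj -/Bm -!mulmxA (mulmxA Bm) BQP.
clearbody P.
have P1T : P1^T = P1 by rewrite !trmx_mul trmxK PT mulmxA.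
have P01 : P0 *m P1 = P1 by rewrite -[LHS]trmxK trmx_mul P1T block_proj_sym P10 P1T.
have P11 : P1 *m P1 = P1.
  rewrite /P1 !mulmxA -[Q *m P *m Q^T *m Q]mulmxA QQ' mulmx1.
  by rewrite -[Q *m P *m P]mulmxA PP.
have trP1 : \tr P1 = (\dim U)%:R.
  by rewrite /P1 mxtrace_mulC mulmxA QQ' mul1mx trP.
(* Nested projections of equal rank coincide: [P0 - P1] is symmetric, and its square [P0 - P1] has
   trace 0. *)
have P0P1 : P0 - P1 = 0.
  apply: mxtr_sym_eq0; first by rewrite linearB /= P1T block_proj_sym.
  rewrite mulmxBl !mulmxBr block_proj_id P01 P10 P11 subrr subr0.
  by rewrite linearB /= trP1 block_proj_tr // subrr.
exists Q^T; first by rewrite trmxK.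
have -> : P0 = P1 by apply/eqP; rewrite -subr_eq0 P0P1.
by rewrite trmxK /P1 !mulmxA QQ' mul1mx -mulmxA QQ' mulmx1.
Qed.

End ProjectionGeometry.

Section PolynomialFunctions.
Variables (R : realType) (m n : nat).
Local Notation G := (grassmannian R m n).
Implicit Types (p : G) (s : seq ('I_n * 'I_n)) (f : G -> R).

Definition monom s p : R := \prod_(z <- s) orth_proj p z.1 z.2.

(** Linear combinations are compared pointwise, which includes stability under pointwise
    equality. *)
Definition fun_closed (Pt : (G -> R) -> Prop) :=
  Pt (fun=> 0) /\
  forall a f g h, Pt f -> Pt g -> (forall p, h p = a * f p + g p) -> Pt h.

Lemma fun_closed_ext Pt f g : fun_closed Pt -> Pt f -> (forall p, g p = f p) -> Pt g.
Proof.
move=> [P0 PL] Pf E; apply: (PL 1 f (fun=> 0)) => // p.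
by rewrite mul1r addr0.
Qed.

Lemma fun_closed_sum Pt (J : Type) (r : seq J) (F : J -> G -> R) : fun_closed Pt ->
  (forall j, Pt (F j)) -> Pt (fun p => \sum_(j <- r) F j p).
Proof.
move=> Pc PF; elim: r => [|j r IH].
  by apply: (fun_closed_ext Pc Pc.1) => p; rewrite big_nil.
apply: (Pc.2 1 (F j) _ _ (PF j) IH) => p.
by rewrite big_cons mul1r.
Qed.

Lemma fun_closedZ Pt a f : fun_closed Pt -> Pt f -> Pt (fun p => a * f p).
Proof. by move=> [P0 PL] Pf; apply: (PL a f (fun=> 0)) => // p; rewrite addr0. Qed.

Definition poly_le d f := exists2 l : seq (R * seq ('I_n * 'I_n)),
  all (fun x => size x.2 <= d)%N l & forall p, f p = \sum_(x <- l) x.1 * monom x.2 p.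

Lemma poly_le_closed d : fun_closed (poly_le d).
Proof.
split=> [|a f g h [l1 s1 E1] [l2 s2 E2] hE]; first by exists [::] => // p; rewrite big_nil.
exists ([seq (a * x.1, x.2) | x <- l1] ++ l2).
  by rewrite all_cat s2 andbT all_map.
move=> p; rewrite hE E1 E2 big_cat big_map mulr_sumr /=; congr (_ + _).
by apply: eq_bigr => x _; rewrite mulrA.
Qed.

Lemma poly_le_monom d s : (size s <= d)%N -> poly_le d (monom s).
Proof. by move=> sd; exists [:: (1, s)]; rewrite /= ?sd // => p; rewrite big_seq1 mul1r. Qed.

Lemma poly_le_mul d f x y : poly_le d f -> poly_le d.+1 (fun p => f p * orth_proj p x y).
Proof.
move=> [l sl E]; exists [seq (z.1, (x, y) :: z.2) | z <- l].
  by rewrite all_map; apply: sub_all sl => z /=.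
move=> p; rewrite E big_map mulr_suml; apply: eq_bigr => z _ /=.
by rewrite /monom big_cons /= -mulrA [_ * orth_proj _ _ _]mulrC.
Qed.

Lemma poly_le_widen d f : poly_le d f -> poly_le d.+1 f.
Proof.
by move=> [l sl E]; exists l => //; apply: sub_all sl => z /leqW.
Qed.

Lemma poly_le_ind Pt d f : fun_closed Pt ->
  (forall s, (size s <= d)%N -> Pt (monom s)) -> poly_le d f -> Pt f.
Proof.
move=> Pc PM [l sl E]; apply: (fun_closed_ext Pc _ E); elim: l sl {E} => [_|x l IH].
  by apply: (fun_closed_ext Pc Pc.1) => p; rewrite big_nil.
move=> /andP[/= sx /IH Pl]; apply: (Pc.2 x.1 _ _ _ (PM _ sx) Pl) => p.
by rewrite big_cons.
Qed.

Definition proj_tens k p : tens R n ('I_k * bool) := ptens id (fun=> orth_proj p).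

Definition tens_fun k f := exists v, forall p, f p = dot (proj_tens k p) v.

Lemma tens_fun_closed k : fun_closed (tens_fun k).
Proof.
split=> [|a f g h [v fE] [w gE] hE]; first by exists 0 => p; rewrite dot0r.
by exists (a *: v + w) => p; rewrite hE fE gE dotPr.
Qed.

Lemma tens_fun_monom k s : size s = k -> tens_fun k (monom s).
Proof.
move=> /eqP sk; pose u := Tuple sk.
exists (basis_vec R [ffun x : 'I_k * bool => if x.2 then (tnth u x.1).2 else (tnth u x.1).1]).
move=> p; rewrite dot_basis ffunE /monom -[s]/(tval u) big_tuple.
by apply: eq_bigr => a _; rewrite !ffunE.
Qed.

Lemma monom_trace s p : \sum_x monom ((x, x) :: s) p = m%:R * monom s p.
Proof.
rewrite -(eqP (gspace_dim p)) -orth_proj_tr /mxtrace mulr_suml.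
by apply: eq_bigr => x _; rewrite /monom big_cons.
Qed.

(* Since [\tr (orth_proj p) = m] is constant, low degrees embed in degree [t]. *)
Lemma poly_le_tens t f : (0 < m)%N -> poly_le t f -> tens_fun t f.
Proof.
move=> m0; apply: poly_le_ind; first exact: tens_fun_closed.
move=> s st; move: {-1}(t - size s)%N (erefl (t - size s)%N) => k.
elim: k s st => [|k IH] s st sk.
  apply: tens_fun_monom; apply/eqP; rewrite eqn_leq st /=.
  by rewrite -subn_eq0 sk.
have lt : (size s < t)%N by rewrite -subn_gt0 sk.
apply: (@fun_closed_ext _ (fun p => m%:R^-1 * \sum_x monom ((x, x) :: s) p)).
- exact: tens_fun_closed.
- apply: fun_closedZ; first exact: tens_fun_closed.
  apply: fun_closed_sum => [|x]; first exact: tens_fun_closed.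
  by apply: IH => //=; rewrite subnS sk.
- by move=> p; rewrite monom_trace mulKf // pnatr_eq0 -lt0n.
Qed.

Lemma proj_tens_act k (g : Defs.orthogonal R n) p :
  proj_tens k (Defs.gact g p) = mact g (proj_tens k p).
Proof.
rewrite /proj_tens mact_ptens; last by exists id.
by apply/ffunP => i; rewrite !ffunE orth_proj_rot.
Qed.

Lemma dot_ptens_id k (X Y : 'M[R]_n) :
  dot (ptens (@id ('I_k * bool)) (fun=> X)) (ptens id (fun=> Y)) = \tr (X *m Y^T) ^+ k.
Proof.
pose J (f : {ffun 'I_k -> 'I_n * 'I_n}) : {ffun 'I_k * bool -> 'I_n} :=
  [ffun b => if b.2 then (f b.1).2 else (f b.1).1].
rewrite /dot (reindex J) /=; last first.
  exists (fun j => [ffun a => (j (a, false), j (a, true))]) => j _; apply/ffunP => x.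
    by rewrite !ffunE; case: (j x).
  by rewrite !ffunE; case: x => a [].
transitivity (\sum_(f : {ffun 'I_k -> 'I_n * 'I_n}) \prod_a (X (f a).1 (f a).2 * Y (f a).1 (f a).2)).
  apply: eq_bigr => f _; rewrite !ffunE -big_split /=.
  by apply: eq_bigr => a _; rewrite !ffunE.
rewrite -(bigA_distr_bigA (fun (a : 'I_k) (z : 'I_n * 'I_n) => X z.1 z.2 * Y z.1 z.2)).
rewrite prodr_const card_ord; congr (_ ^+ _).
rewrite /mxtrace; under [RHS]eq_bigr do rewrite mxE.
by rewrite pair_bigA; apply: eq_bigr => z _; rewrite mxE.
Qed.

Lemma dot_proj_tens k p q : dot (proj_tens k p) (proj_tens k q) = sigma p q ^+ k.
Proof. by rewrite dot_ptens_id orth_proj_sym. Qed.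

End PolynomialFunctions.

(** * Highest weight vectors *)

(** The leading block of size [k] is triangular with nonzero determinant. *)
Lemma upper_rank (R : realType) (n k : nat) (U : 'M[R]_n) : (k <= n)%N -> upper U ->
  (forall c : 'I_n, (c < k)%N -> U c c != 0) -> (k <= \rank U)%N.
Proof.
move=> kn uU Ud; pose f := widen_ord kn; pose V : 'M[R]_k := mxsub f f U.
have dV : \det V != 0.
  rewrite -det_tr det_trig; last first.
    by apply/is_trig_mxP => i j ij; rewrite !mxE uU.
  by apply/prodf_neq0 => i _; rewrite !mxE; apply: Ud; exact: (ltn_ord i).
have rV : \rank V = k by apply/eqP; rewrite -/(row_free V) row_free_unit unitmxE unitfE.
have VE : V = rowsub f 1%:M *m U *m colsub f 1%:M.
  apply/matrixP => i j; rewrite !mxE (bigD1 (f j)) //= big1 ?addr0 => [|l /negPf lj].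
    rewrite !mxE eqxx mulr1 (bigD1 (f i)) //= big1 ?addr0 => [|l /negPf li].
      by rewrite !mxE eqxx mul1r.
    by rewrite !mxE eq_sym li mul0r.
  by rewrite !mxE lj mulr0.
by rewrite -rV VE (leq_trans (mxrankM_maxl _ _)) // mxrankM_maxr.
Qed.

Section ContentParts.
Variables (R : realType) (n : nat) (B : finType).
Variable X : tens R n B -> Prop.
Hypotheses (Xlin : lin_closed X) (Xmact : forall g y, X y -> X (mact g y)).

(** The diagonal matrix with 2 at [a] and 1 elsewhere has eigenvalues [2 ^+ content i a], and
    polynomials in it preserve [X]. *)
Lemma letter_poly a (q : {poly R}) y : X y ->
  X [ffun i : {ffun B -> 'I_n} => q.[2 ^+ content i a] * y i].
Proof.
move=> Xy; elim/poly_ind: q => [|q c IH].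
  suff -> : [ffun i : {ffun B -> 'I_n} => (0 : {poly R}).[2 ^+ content i a] * y i] = 0 :> tens R n B.
    exact: Xlin.1.
  by apply/ffunP => i; rewrite !ffunE horner0 mul0r.
pose D : 'M[R]_n := diag_mx (\row_j (if j == a then 2 else 1)).
have DE z i : mact D z i = 2 ^+ content i a * z i.
  rewrite ffunE (bigD1 i) //= [X in _ + X]big1 ?addr0 => [|j ji]; last first.
    have [b ijb] : exists b, i b != j b.
      apply/existsP; apply: contraR ji; rewrite negb_exists => /forallP ij.
      by apply/eqP/ffunP => b; have := ij b; rewrite negbK => /eqP.
    by rewrite (bigD1 b) //= mxE (negPf ijb) mulr0n !mul0r.
  rewrite (prod_content (fun c => D c c)) (bigD1 a) //= [X in _ * X * _]big1 ?mulr1.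
    by rewrite !mxE !eqxx.
  by move=> d /negPf da; rewrite !mxE eqxx da mulr1n expr1n.
have := Xlin.2 c _ _ Xy (Xmact D IH); congr X; apply/ffunP => i.
rewrite ffunE DE !ffunE hornerMXaddC /GRing.scale /=; ring.
Qed.

(** Lagrange interpolation at the distinct eigenvalues [2 ^+ l], for [l] at most the number of
    factors. *)
Lemma letter_part a (k : nat) y : X y ->
  X [ffun i : {ffun B -> 'I_n} => (content i a == k)%:R * y i].
Proof.
move=> Xy; pose N := #|B|.+1.
have [kN|Nk] := ltnP k N; last first.
  suff -> : [ffun i : {ffun B -> 'I_n} => (content i a == k)%:R * y i] = 0 :> tens R n B.
    exact: Xlin.1.
  apply/ffunP => i; rewrite !ffunE ltn_eqF ?mul0r //.
  by apply: leq_trans Nk; rewrite ltnS max_card.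
pose q : {poly R} := \prod_(l < N | l != k :> nat) ('X - (2 ^+ l)%:P).
have pow_inj (l l' : nat) : (2 ^+ l == 2 ^+ l' :> R) = (l == l').
  by rewrite -!natrX eqr_nat eqn_exp2l.
have qk : q.[2 ^+ k] != 0.
  rewrite horner_prod; apply/prodf_neq0 => l lk.
  by rewrite hornerXsubC subr_eq0 pow_inj eq_sym.
have := letter_poly a (q.[2 ^+ k]^-1 *: q) Xy; congr X; apply/ffunP => i.
rewrite !ffunE hornerZ -/(content i a).
have [ck|ck] := eqVneq #|[pred b | i b == a]| k.
  by rewrite ck mulVf.
have cN : (#|[pred b | i b == a]| < N)%N by rewrite ltnS max_card.
have -> : q.[2 ^+ #|[pred b | i b == a]|] = 0.
  by rewrite horner_prod (bigD1 (Ordinal cN)) //= hornerXsubC subrr mul0r.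
by rewrite mulr0 !mul0r.
Qed.

Lemma content_part_closed c y : X y -> X (content_part c y).
Proof.
move=> Xy.
have H (l : seq 'I_n) : X [ffun i : {ffun B -> 'I_n} => (all (fun a => content i a == c a) l)%:R * y i].
  elim: l => [|a l IH].
    by move: Xy; congr X; apply/ffunP => i; rewrite ffunE /= mul1r.
  have := letter_part a (c a) IH; congr X; apply/ffunP => i.
  rewrite !ffunE /=.
  have -> : content i a = #|[pred b | i b == a]| by rewrite ffunE.
  by case: (#|[pred b | i b == a]| == c a); rewrite /= ?mul1r ?mul0r.
have := H (enum 'I_n); congr X; apply/ffunP => i; rewrite !ffunE; congr (_%:R * _).
congr nat_of_bool; apply/allP/eqP => [E|<- a _]; last exact: eqxx.
by apply/ffunP => a; apply/eqP/E; rewrite mem_enum.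
Qed.

End ContentParts.

(** The shape [2 mu] is tiled by horizontal dominoes, one for each box of [mu]. *)
Lemma box_matching (m K : nat) (mu : m.-tuple nat) : sumn mu = K ->
  exists (h : 'I_K * bool -> box (fun i => 2 * tnth mu i)%N) (k : 'I_K -> nat),
  [/\ bijective h, forall a, box_row (h (a, true)) = box_row (h (a, false)) &
    forall a e, box_col (h (a, e)) = (e + (k a).*2)%N].
Proof.
move=> muK; pose A := {i : 'I_m & 'I_(tnth mu i)}.
have cardT (F : 'I_m -> nat) : #|{: {i : 'I_m & 'I_(F i)}}| = (\sum_i F i)%N.
  rewrite card_tagged sumnE big_map big_enum /=.
  by apply: eq_bigr => i _; rewrite card_ord.
have sumT : (\sum_i tnth mu i)%N = K by rewrite -muK sumnE big_tuple.
have cA : #|{: A}| = K by rewrite cardT.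
pose f (a : 'I_K) : A := enum_val (cast_ord (esym cA) a).
have finj : injective f by move=> a b /enum_val_inj/cast_ord_inj.
have lt (x : A) (e : bool) : (e + (tagged x : nat).*2 < 2 * tnth mu (tag x))%N.
  rewrite mul2n; case: x => i j /=; case: e; rewrite ?add1n ?add0n ?ltn_double //.
  by rewrite ltn_Sdouble.
pose h (x : 'I_K * bool) : box (fun i => 2 * tnth mu i)%N :=
  Tagged (fun i => 'I_(2 * tnth mu i)) (Ordinal (lt (f x.1) x.2)).
exists h, (fun a => nat_of_ord (tagged (f a))); split=> //.
apply: inj_card_bij; last first.
  rewrite card_prod card_ord card_bool.
  rewrite (cardT (fun i => 2 * tnth mu i)%N).
  by rewrite -big_distrr /= sumT mulnC.
move=> [a e] [a' e'] E.
have row : tag (f a) = tag (f a') by have := congr1 (@box_row _ _) E.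
have col : (e + (tagged (f a) : nat).*2 = e' + (tagged (f a') : nat).*2)%N.
  by have := congr1 (@box_col _ _) E.
have ee : e = e' by have := congr1 odd col; rewrite !oddD !odd_double !addbF !oddb.
rewrite ee in col *; congr (_, _); apply: finj.
move/addnI/double_inj: col; move: row; case: (f a) (f a') => [i j] [i' j'] /= ii.
by subst i' => /val_inj ->.
Qed.

Section HighestWeight.
Variables (R : realType) (m n K : nat).
Hypothesis mn : (m <= n)%N.
Local Notation slots := ('I_K * bool)%type.
Implicit Types (x y v : tens R n slots).

Definition gram_orth v := forall A : 'M[R]_n, (\rank A <= m)%N ->
  dot (ptens id (fun=> A^T *m A)) v = 0.

Definition young_orth y := forall (mu : m.-tuple nat)
  (h : box (fun i => 2 * tnth mu i)%N -> slots) (T : tens R n (box (fun i => 2 * tnth mu i)%N)),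
  sorted geq mu -> sumn mu = K -> bijective h ->
  dot y (reidx h (young_symmetrizer T)) = 0.

(** The first condition expresses by double orthogonality that [y] is in the span of the powers of
    Gram matrices of rank at most [m]. No orthogonal group enters: the space is stable under all
    matrices. *)
Definition hw_space y := (forall v, gram_orth v -> dot y v = 0) /\ young_orth y.

Lemma hw_space_lin : lin_closed hw_space.
Proof.
split=> [|a y z [y1 y2] [z1 z2]].
  by split=> [v _|mu h T _ _ _]; rewrite dot0l.
split=> [v vo|mu h T smu sK hb]; rewrite dotP.
  by rewrite y1 // z1 // mulr0 addr0.
by rewrite y2 // z2 // mulr0 addr0.
Qed.

Lemma hw_space_mact (g : 'M[R]_n) y : hw_space y -> hw_space (mact g y).
Proof.
move=> [y1 y2]; split=> [v vo|mu h T smu sK hb].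
  rewrite mact_dot; apply: y1 => A rA; rewrite -mact_dot mact_ptens; last by exists id.
  rewrite -[RHS](vo (A *m g^T)); last by rewrite (leq_trans (mxrankM_maxl _ _)).
  by congr (dot (ptens _ _) _); apply/funext => a; rewrite trmx_mul trmxK !mulmxA.
by rewrite mact_dot reidx_mact // young_mact y2.
Qed.

Lemma mact_perm (s : {perm 'I_n}) y (i : {ffun slots -> 'I_n}) :
  mact (\matrix_(a, b) (b == s a)%:R) y i = y [ffun b => s (i b)].
Proof.
rewrite ffunE (bigD1 [ffun b => s (i b)]) //= [X in _ + X]big1 ?addr0 => [|j ji].
  by rewrite [X in X * _]big1 ?mul1r // => b _; rewrite mxE ffunE eqxx.
have [b ijb] : exists b, j b != s (i b).
  apply/existsP; apply: contraR ji; rewrite negb_exists => /forallP ij.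
  by apply/eqP/ffunP => b; have := ij b; rewrite negbK ffunE => /eqP.
by rewrite (bigD1 b) //= mxE (negPf ijb) !mul0r.
Qed.

Lemma hw_space0 x : hw_space x -> x = 0.
Proof.
move=> Xx; apply/eqP; apply: contraT => x0.
(* The minimum is taken over the supports of all elements of [hw_space], so that it also bounds the
   images of [z] under matrices. *)
pose S i := `[< exists2 y, hw_space y & y i != 0 >].
have [i1 Si1] : exists i, S i.
  have [i xi] : exists i, x i != 0.
    apply/existsP; apply: contraR x0; rewrite negb_exists => /forallP H.
    by apply/eqP/ffunP => i; have := H i; rewrite negbK ffunE => /eqP.
  by exists i; apply/asboolP; exists x.
have [i0 /asboolP[y Xy yi0] i0min] := @arg_minnP _ i1 S (@weight n _) Si1.
have {}i0min y' i : hw_space y' -> y' i != 0 -> (weight i0 <= weight i)%N.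
  by move=> Xy' yi; apply: i0min; apply/asboolP; exists y'.
pose nu := content i0; pose z := content_part nu y.
have Xz : hw_space z by exact: (content_part_closed hw_space_lin hw_space_mact).
have zi0 : z i0 != 0 by rewrite ffunE eqxx mul1r.
have zc i : z i != 0 -> content i = nu.
  by rewrite ffunE; have [//|_] := eqVneq (content i) nu; rewrite mul0r eqxx.
pose wt (U : 'M[R]_n) := \prod_a U a a ^+ nu a.
have zU U : upper U -> mact U z = wt U *: z.
  move=> uU; apply/ffunP => i; rewrite [RHS]ffunE.
  have [zi|zi] := eqVneq (z i) 0; last first.
    have yi : y i != 0 by apply: contra zi => /eqP yi; rewrite ffunE yi mulr0.
    by apply: upper_lowest => // j; exact: i0min.
  rewrite zi scaler0; apply/eqP; apply: contraT => Uzi.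
  have wi := i0min _ _ (hw_space_mact U Xz) Uzi.
  case/negP: Uzi; rewrite ffunE big1 // => j _.
  have [->|zj] := eqVneq (z j) 0; first by rewrite mulr0.
  rewrite upper_prod ?mul0r //.
    by rewrite (weight_content j) (zc _ zj) -weight_content.
  by apply: contraNneq zj => <-; rewrite zi.
have gramU (A : 'M[R]_n) : exists2 U : 'M[R]_n, upper U & A^T *m A = U^T *m U /\ (\rank U <= \rank A)%N.
  have [Q [QQ uQ]] := qr A; exists (Q *m A) => //; split.
    rewrite trmx_mul mulmxA -[A^T *m Q^T *m Q]mulmxA.
    by rewrite (_ : Q^T *m Q = 1%:M) ?mulmx1 //; exact: mulmx1C.
  exact: mxrankM_maxr.
pose one (B : finType) (h : 'I_K * bool -> B) : tens R n B := ptens h (fun=> 1%:M).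
have ptU (B : finType) (h : 'I_K * bool -> B) (U : 'M[R]_n) : bijective h ->
    ptens h (fun=> U^T *m U) = mact U^T (one B h).
  move=> hb; rewrite mact_ptens //; congr (ptens _ _); apply/funext => a.
  by rewrite mulmx1 trmxK.
have idb : bijective (@id slots) by exists id.
pose f1 := dot z (one _ id).
have fU U : upper U -> dot z (ptens id (fun=> U^T *m U)) = wt U * f1.
  by move=> uU; rewrite ptU // dotC mact_dot trmxK zU // dotC dotZl.
have zz : dot z z != 0.
  by apply: contra zi0 => /eqP/dot_eq0 ->; rewrite ffunE.
(* Otherwise [z] would be orthogonal to every Gram power and, lying in their span, to itself. *)
have [U0 [uU0 rU0 wf]] : exists U0, [/\ upper U0, (\rank U0 <= m)%N & wt U0 * f1 != 0].
  apply: contrapT => H; case/negP: zz; apply/eqP; apply: Xz.1 => A rA.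
  have [U uU [-> rU]] := gramU A; rewrite dotC fU //.
  apply/eqP; apply: contraT => wf; case: H; exists U; split=> //.
  exact: leq_trans rA.
have [wU0 f10] : wt U0 != 0 /\ f1 != 0 by move: wf; rewrite mulf_eq0 negb_or => /andP[].
(* If the larger letter occurred more often, exchanging the two letters would lower the weight below
   the minimum. *)
have nu_dec (a c : 'I_n) : (a < c)%N -> (nu c <= nu a)%N.
  move=> ac; rewrite leqNgt; apply/negP => nuac.
  pose i := [ffun b => tperm a c (i0 b)].
  have : mact (\matrix_(d, b) (b == tperm a c d)%:R) z i != 0.
    rewrite mact_perm (_ : finfun _ = i0) //.
    by apply/ffunP => b; rewrite !ffunE tpermK.
  move=> /(i0min _ _ (hw_space_mact _ Xz)).
  have sumw (g : 'I_n -> nat) : (\sum_b g (i0 b) = \sum_d nu d * g d)%N.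
    rewrite (partition_big i0 predT) //=; apply: eq_bigr => d _.
    by rewrite ffunE -sum_nat_const; apply: eq_bigr => b /eqP ->.
  have -> : weight i = (\sum_d nu d * tperm a c d)%N.
    by rewrite -sumw; apply: eq_bigr => b _; rewrite ffunE.
  rewrite /weight (sumw (fun d => d : nat)).
  rewrite (bigD1 a) // (bigD1 c) /=; last by rewrite -val_eqE /= gtn_eqF.
  rewrite [X in (_ <= X)%N](bigD1 a) // [X in (_ <= _ + X)%N](bigD1 c) /=; last by rewrite -val_eqE /= gtn_eqF.
  rewrite tpermL tpermR.
  have -> : (\sum_(d < n | (d != a) && (d != c)) nu d * tperm a c d =
             \sum_(d < n | (d != a) && (d != c)) nu d * d)%N.
    by apply: eq_bigr => d /andP[da dc]; rewrite tpermD // eq_sym.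
  move: ac nuac; set s := (\sum_(d < n | _) _)%N; move: (nu a) (nu c) (a : nat) (c : nat).
  by move=> p q a' c' ac pq; nia.
(* As [wt U0] is nonzero, [U0] has nonzero diagonal entries at all letters that occur; by [nu_dec] a
   letter [a >= m] would give it rank greater than [m]. *)
have nu0 (a : 'I_n) : (m <= a)%N -> nu a = 0%N.
  move=> ma; apply/eqP; apply: contraT => na.
  suff : (a.+1 <= \rank U0)%N by move=> /leq_trans/(_ rU0); rewrite leqNgt ltnS ma.
  apply: upper_rank => // c ca; apply: contra wU0 => /eqP Uc.
  rewrite /wt (bigD1 c) //= Uc expr0n; have -> : (nu c == 0%N) = false.
    apply/negbTE; rewrite -lt0n; move: ca; rewrite ltnS leq_eqVlt => /orP[/eqP/val_inj ->|ca].
      by rewrite lt0n.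
    by apply: leq_trans (nu_dec _ _ ca); rewrite lt0n.
  by rewrite mul0r.
(* An index of content [nu] whose letters agree inside each pair, which shows that [nu] is even. *)
have [i zi oi] : exists2 i, z i != 0 & one _ id i != 0.
  apply: contrapT => H; case/negP: f10; apply/eqP; apply: big1 => i _.
  have [->|zi] := eqVneq (z i) 0; first by rewrite mul0r.
  have [->|oi] := eqVneq (one slots id i) 0; first by rewrite mulr0.
  by case: H; exists i.
have ieq a : i (a, true) = i (a, false).
  apply/eqP; apply: contraR oi => ne.
  by rewrite ffunE (bigD1 a) //= mxE (eq_sym (i (a, false))) (negPf ne) mul0r.
pose M (a : 'I_n) := #|[pred j : 'I_K | i (j, false) == a]|.
have nuM a : nu a = (2 * M a)%N.
  rewrite -(zc _ zi) ffunE /M -!sum1_card.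
  rewrite big_mkcond /= [in RHS]big_mkcond /=.
  transitivity (\sum_(j < K) \sum_(e : bool) if i (j, e) == a then 1 else 0)%N.
    by rewrite pair_bigA; apply: eq_bigr => -[].
  rewrite big_distrr /=; apply: eq_bigr => j _.
  by rewrite big_bool /= ieq mul2n -addnn.
have sumM : (\sum_a M a)%N = K.
  rewrite -[RHS]card_ord -sum1_card (partition_big (fun j : 'I_K => i (j, false)) predT) //=.
  by apply: eq_bigr => a _; rewrite /M -sum1_card.
pose mu : m.-tuple nat := [tuple M (widen_ord mn a) | a < m].
have muE a : tnth mu a = M (widen_ord mn a) by rewrite tnth_mktuple.
have smu : sorted geq mu.
  apply/(sortedP 0%N) => j; rewrite size_tuple => jm.
  have jm' := ltnW jm.
  have -> : nth 0%N mu j = tnth mu (Ordinal jm') by rewrite (tnth_nth 0%N).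
  have -> : nth 0%N mu j.+1 = tnth mu (Ordinal jm) by rewrite (tnth_nth 0%N).
  rewrite /= !muE -(leq_pmul2l (isT : (0 < 2)%N)) -!nuM.
  by apply: nu_dec; rewrite /=.
have sumK : sumn mu = K.
  rewrite sumnE big_tuple -[RHS]sumM.
  rewrite (eq_bigr (fun a => M (widen_ord mn a))) => [|a _]; last by rewrite muE.
  rewrite (bigID (fun a : 'I_n => (a < m)%N)) /= [X in (_ + X)%N]big1 ?addn0; last first.
    move=> a; rewrite -leqNgt => /nu0; rewrite nuM => /eqP.
    by rewrite muln_eq0 => /eqP.
  by rewrite (big_ord_narrow mn).
have [h [k [hb hrow hcol]]] := box_matching sumK.
pose lam (i : 'I_m) := (2 * tnth mu i)%N.
have lam_dec (a c : 'I_m) : (a <= c)%N -> (lam c <= lam a)%N.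
  rewrite leq_eqVlt => /orP[/eqP/val_inj -> //|ac].
  by rewrite /lam !muE -!nuM; exact: nu_dec.
pose rho := highest_index lam mn.
have rho_nu : content rho = nu.
  apply/ffunP => a; rewrite ffunE; have [am|ma] := ltnP a m; last first.
    rewrite nu0 //; apply: eq_card0 => b; rewrite !inE ffunE.
    by apply: contraTF ma => /eqP <-; rewrite -ltnNge /= ltn_ord.
  have aE : a = widen_ord mn (Ordinal am) by apply: val_inj.
  rewrite nuM aE -muE -/(lam _) -sum1_card.
  transitivity (\sum_(i | i == Ordinal am) \sum_(j < lam i) 1)%N; last first.
    by rewrite big_pred1_eq sum_nat_const card_ord muln1.
  rewrite sig_big_dep; apply: eq_bigl => b.
  by rewrite inE ffunE andbT -!val_eqE.
pose Y : tens R n (box lam) := young_symmetrizer (basis_vec R rho).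
have Y1 : 0 < dot Y (one _ h) by apply: (young_highest_pairing R mn hb hrow hcol).
have YU U : upper U -> mact U Y = wt U *: Y.
  by move=> uU; rewrite /Y young_mact young_upper // rho_nu.
have [h' hK h'K] := hb.
pose w : tens R n slots := reidx h' Y.
have zw : dot z w = 0.
  by apply: Xz.2 => //; exists h.
(* Both [z] and [w] pair with the power of [U^T U] as [wt U] times a constant; [c] equates these
   constants, so that [z - c *: w] is orthogonal to all Gram powers. *)
pose c := f1 / dot Y (one _ h).
have zv : dot z (z - c *: w) = 0.
  apply: Xz.1 => A rA; have [U uU [-> rU]] := gramU A.
  rewrite dotBr dotZr [dot _ z]dotC fU // (reidx_dot _ _ h'K hK) reidx_ptens.
  rewrite -[h \o id]/h ptU // mact_dot trmxK YU // dotZr [dot _ Y]dotC.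
  by rewrite mulrCA divfK ?subrr // gt_eqF.
by case/negP: zz; rewrite -zv dotBr dotZr zw mulr0 subr0.
Qed.

End HighestWeight.

(** * Polynomial functions as sums of isotypic functions *)

Lemma dot_mact_orth (R : realType) (n : nat) (B : finType) (g : Defs.orthogonal R n)
  (S T : tens R n B) : dot (mact g S) (mact g T) = dot S T.
Proof. by rewrite mact_dot mactM orthogonal_trmul mact1. Qed.

Section Span.
Variables (R : realType) (m n : nat).
Local Notation G := (grassmannian R m n).
Implicit Types (p : G).

Lemma continuous_entry i j : continuous (fun p : G => orth_proj p i j : R).
Proof.
move=> p; apply: (@continuous_comp _ _ _ (fun p : G => orth_proj p) (fun M : 'M[R]_n => M i j)).
  exact: initial_continuous.
exact: coord_continuous.
Qed.

Lemma continuous_sum_seq (J : Type) (l : seq J) (F : J -> G -> R) :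
  (forall j, continuous (F j)) -> continuous (fun p : G => \sum_(j <- l) F j p).
Proof.
move=> FC; elim: l => [|j l IH].
  have -> : (fun p => \sum_(j <- [::]) F j p) = cst 0 by apply/funext => q; rewrite big_nil.
  exact: cst_continuous.
have -> : (fun p => \sum_(k <- j :: l) F k p) = (fun q => F j q + \sum_(k <- l) F k q).
  by apply/funext => q; rewrite big_cons.
by move=> p; apply: continuousD; [exact: FC|exact: IH].
Qed.

Lemma continuous_prod_seq (J : Type) (l : seq J) (F : J -> G -> R) :
  (forall j, continuous (F j)) -> continuous (fun p : G => \prod_(j <- l) F j p).
Proof.
move=> FC; elim: l => [|j l IH].
  have -> : (fun p => \prod_(j <- [::]) F j p) = cst 1 by apply/funext => q; rewrite big_nil.
  exact: cst_continuous.
have -> : (fun p => \prod_(k <- j :: l) F k p) = (fun q => F j q * \prod_(k <- l) F k q).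
  by apply/funext => q; rewrite big_cons.
by move=> p; apply: continuousM; [exact: FC|exact: IH].
Qed.

Lemma continuous_dot_ptens (A B : finType) (h : A * bool -> B) (T : tens R n B) :
  continuous (fun p : G => dot (ptens h (fun=> orth_proj p)) T : R).
Proof.
have pc (i : {ffun B -> 'I_n}) : continuous (fun p : G => ptens h (fun=> orth_proj p) i : R).
  have -> : (fun p : G => ptens h (fun=> orth_proj p) i : R) =
     (fun q : G => \prod_a orth_proj q (i (h (a, false))) (i (h (a, true)))).
    by apply/funext => q; rewrite ffunE.
  by apply: continuous_prod_seq => a; exact: continuous_entry.
apply: continuous_sum_seq => i p; apply: continuousM; first exact: pc.
exact: cst_continuous.
Qed.

Lemma ptens_intertwiner (A : finType) (lam : 'I_m -> nat) (h : A * bool -> box lam) :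
  bijective h ->
  intertwiner (fun (T : tensor R n lam) p => dot (ptens h (fun=> orth_proj p)) T).
Proof.
move=> hb; split=> [a S T p _ _|g T p _|T _]; first exact: dotPr.
  rewrite -[RHS](dot_mact_orth g) mact_ptens //; congr (dot (ptens _ _) _).
  by apply/funext => a; rewrite orth_proj_rot.
exact: continuous_dot_ptens.
Qed.

(** Contracting the two legs of one factor gives the trace [m]; contracting legs of two factors
    merges them, since [P P = P]. Either way one factor disappears. *)
Lemma contraction_poly k (B : finType) (h : 'I_k.+1 * bool -> B) (b c : B)
  (i : {ffun B -> 'I_n}) : bijective h -> b != c ->
  poly_le k (fun p : G => dot (ptens h (fun=> orth_proj p)) (insertion R b c i)).
Proof.
move=> [h' hK h'K] bc.
pose P p (a : 'I_n) (j : 'I_k.+1) : R :=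
  orth_proj p (upd b c i a (h (j, false))) (upd b c i a (h (j, true))).
have E p : dot (ptens h (fun=> orth_proj p)) (insertion R b c i) = \sum_a \prod_j P p a j.
  by rewrite dot_insertion; apply: eq_bigr => a _; rewrite ffunE.
have off p a (j : 'I_k.+1) : (h' b).1 != j -> (h' c).1 != j ->
    P p a j = orth_proj p (i (h (j, false))) (i (h (j, true))).
  move=> bj cj; rewrite /P !ffunE.
  have ne e x : (h' x).1 != j -> (h (j, e) == x) = false.
    by move=> xj; apply: contraNF xj => /eqP <-; rewrite hK.
  by rewrite !ne.
have cntE (Q : pred 'I_k.+1) : count Q (enum 'I_k.+1) = #|Q|.
  by rewrite -size_filter cardE enumT /enum_mem; congr size; apply: eq_filter.
have [bb|bcj] := eqVneq (h' b).1 (h' c).1.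
  pose j := (h' b).1.
  pose s := [seq (i (h (l, false)), i (h (l, true))) | l <- enum 'I_k.+1 & l != j].
  have ss : size s = k.
    by rewrite size_map size_filter cntE (cardC1 j) card_ord.
  apply: (@fun_closed_ext _ _ _ _ (fun p => m%:R * monom s p)).
  - exact: poly_le_closed.
  - apply: fun_closedZ; first exact: poly_le_closed.
    by apply: poly_le_monom; rewrite ss.
  move=> p; have -> : m%:R = \tr (orth_proj p) by rewrite orth_proj_tr (eqP (gspace_dim p)).
  rewrite E /mxtrace mulr_suml.
  apply: eq_bigr => a _; rewrite (bigD1 j) //=; congr (_ * _).
    have [eb [ec [bE cE]]] : exists eb ec, b = h (j, eb) /\ c = h (j, ec).
      exists (h' b).2, (h' c).2; split; first by rewrite -surjective_pairing h'K.
      by rewrite /j bb -surjective_pairing h'K.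
    have ebc : eb != ec by apply: contraNneq bc => e; rewrite bE cE e.
    rewrite /P !ffunE bE cE !(inj_eq (can_inj hK)) !xpair_eqE !eqxx /=.
    by case: eb ec ebc {bE cE} => [] [].
  rewrite /monom big_map big_filter big_enum_cond /=; apply: eq_bigr => l lj.
  by rewrite off // ?bb eq_sym // -/j -bb.
pose j1 := (h' b).1; pose j2 := (h' c).1.
pose x := i (h (j1, ~~ (h' b).2)); pose y := i (h (j2, ~~ (h' c).2)).
have bE : b = h (j1, (h' b).2) by rewrite -surjective_pairing h'K.
have cE : c = h (j2, (h' c).2) by rewrite -surjective_pairing h'K.
pose s := [seq (i (h (l, false)), i (h (l, true))) | l <- enum 'I_k.+1 & (l != j1) && (l != j2)].
have ss : (size ((x, y) :: s) <= k)%N.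
  rewrite /= size_map size_filter cntE.
  have := cardC (pred2 j1 j2); rewrite card2 bcj card_ord => cC.
  have -> : #|[pred l | (l != j1) && (l != j2)]| = #|predC (pred2 j1 j2)|.
    by apply: eq_card => l; rewrite !inE negb_or.
  by case: cC => /eq_leq.
apply: (@fun_closed_ext _ _ _ _ (monom ((x, y) :: s))).
- exact: poly_le_closed.
- exact: poly_le_monom.
move=> p; have -> : monom ((x, y) :: s) p = orth_proj p x y * monom s p by rewrite /monom big_cons.
have -> : orth_proj p x y = \sum_a orth_proj p x a * orth_proj p a y.
  by rewrite -[in LHS]orth_proj_idem mxE.
rewrite E mulr_suml.
apply: eq_bigr => a _; rewrite (bigD1 j1) //= (bigD1 j2) 1?eq_sym //= mulrA.
congr (_ * _); last first.
  rewrite /monom big_map big_filter big_enum_cond /=; apply: eq_bigr => l /andP[l1 l2].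
  by apply: off; rewrite eq_sym.
have side (e : bool) (j : 'I_k.+1) (z : 'I_n) :
    upd b c i a (h (j, e)) = a -> upd b c i a (h (j, ~~ e)) = z -> P p a j = orth_proj p a z.
  by rewrite /P; case: e => /= -> -> //; rewrite orth_proj_symE.
rewrite (side (h' b).2 j1 x) ?(side (h' c).2 j2 y); first by rewrite orth_proj_symE.
- by rewrite ffunE -cE eqxx orbT.
- rewrite ffunE !(can2_eq hK h'K) -!pair_eqE /pair_eq /= -/j1 -/j2 [j2 == j1]eq_sym.
  by rewrite (negPf bcj) eqxx /= /y; case: (h' c).2.
- by rewrite ffunE -bE eqxx.
- rewrite ffunE !(can2_eq hK h'K) -!pair_eqE /pair_eq /= -/j1 -/j2.
  by rewrite (negPf bcj) eqxx orbF /= /x; case: (h' b).2.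
Qed.

(** Induction on the degree [k]: the tensors of top degree that give functions outside [Pt] are
    controlled by [hw_space0], and traces only produce lower degrees. *)
Lemma poly_span t (Pt : (G -> R) -> Prop) : (m <= n)%N -> fun_closed Pt ->
  Pt (fun=> 1) ->
  (forall mu : m.-tuple nat, sorted geq mu -> (1 <= sumn mu <= t)%N ->
     forall f, isotypic_component (fun i => 2 * tnth mu i)%N f -> Pt f) ->
  forall k f, (k <= t)%N -> poly_le k f -> Pt f.
Proof.
move=> mn Pc P1 PH; elim=> [|k IH] f kt; apply: poly_le_ind => // s.
  rewrite leqn0 => /nilP ->; apply: (fun_closed_ext Pc P1) => p.
  by rewrite /monom big_nil.
rewrite leq_eqVlt => /orP[/eqP sk|sk]; last first.
  by apply: IH; [exact: ltnW|exact: poly_le_monom].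
have [v sv] := @tens_fun_monom R m n _ _ sk.
apply: (fun_closed_ext Pc _ sv).
pose A (v : tens R n ('I_k.+1 * bool)) := Pt (fun p => dot (proj_tens k.+1 p) v).
have Alin : lin_closed A.
  split=> [|a x y Ax Ay].
    by apply: (fun_closed_ext Pc Pc.1) => p; rewrite dot0r.
  by apply: (Pc.2 a _ _ _ Ax Ay) => p; rewrite dotPr.
have [a Aa aA] := lin_proj Alin v.
suff /eqP : v - a = 0 by rewrite subr_eq0 => /eqP va; rewrite -[v]/(id v) va in Aa *.
(* It suffices that [A] contains the tensors of [gram_orth] and the Young symmetrizers. The former
   vanish on every [P_p = P_p^T P_p]. *)
apply: (hw_space0 mn); split=> [u uo|mu h T smu sK hb]; apply: aA.
  apply: (fun_closed_ext Pc Pc.1) => p.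
  rewrite -(uo (orth_proj p)); first by rewrite orth_proj_sym orth_proj_idem.
  by rewrite (leq_trans (orth_proj_rank _)) // (eqP (gspace_dim p)).
have [h' hK h'K] := hb.
have h'b : bijective h' by exists h.
pose D (U : tens R n (box (fun i => 2 * tnth mu i)%N)) p := dot (ptens h' (fun=> orth_proj p)) U.
suff DT : Pt (D (young_symmetrizer T)).
  apply: (fun_closed_ext Pc DT) => p.
  by rewrite (reidx_dot _ _ hK h'K) reidx_ptens.
(* By induction [I] contains all insertions of the metric, so the part [T - z] orthogonal to [I] is
   trace-free and its symmetrizer lies in the Weyl module. *)
pose I (U : tens R n (box (fun i => 2 * tnth mu i)%N)) := Pt (D (young_symmetrizer U)).
have Ilin : lin_closed I.
  split=> [|c x y Ix Iy]; last first.
    by apply: (Pc.2 c _ _ _ Ix Iy) => p; rewrite /D -dotPr -young_symmetrizerP.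
  apply: (fun_closed_ext Pc Pc.1) => p; rewrite /D.
  have E : (-1) *: 0 + 0 = 0 :> tensor R n (fun i => 2 * tnth mu i)%N by rewrite scaler0 addr0.
  have := young_symmetrizerP (-1) (0 : tensor R n (fun i => 2 * tnth mu i)%N) 0.
  by rewrite E scaleN1r addNr => ->; rewrite dot0r.
have [z Iz zI] := lin_proj Ilin T.
have Tz : tracefree (T - z).
  move=> b c i bc; rewrite -dot_insertion; apply: zI.
  apply: (IH _ (ltnW kt)); rewrite /D.
  have -> : (fun p => dot (ptens h' (fun=> orth_proj p)) (young_symmetrizer (insertion R b c i))) =
    (fun p : G => \sum_(s in col_stab (fun i => 2 * tnth mu i)%N) \sum_(r in row_stab (fun i => 2 * tnth mu i)%N)
       (-1) ^+ odd_perm s * dot (ptens (r^-1%g \o (s^-1%g \o h')) (fun=> orth_proj p)) (insertion R b c i)).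
    apply/funext => p; rewrite dot_sumr; apply: eq_bigr => s' _.
    rewrite dot_sumr; apply: eq_bigr => r _; rewrite dotZr; congr (_ * _).
    rewrite -![tperm_act _ _]/(reidx _ _).
    rewrite (reidx_dot _ _ (permK s') (permKV s')) (reidx_dot _ _ (permK r) (permKV r)).
    by rewrite !reidx_ptens.
  have sumc (J : Type) (l : seq J) (Q : pred J) (F : J -> G -> R) :
      (forall j, poly_le k (F j)) -> poly_le k (fun p => \sum_(j <- l | Q j) F j p).
    move=> FP; have -> : (fun p => \sum_(j <- l | Q j) F j p) = (fun p => \sum_(j <- [seq j <- l | Q j]) F j p).
      by apply/funext => p; rewrite big_filter.
    by apply: fun_closed_sum => //; exact: poly_le_closed.
  apply: (sumc _ _ _ _ _) => s'; apply: (sumc _ _ _ _ _) => r; apply: fun_closedZ; first exact: poly_le_closed.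
  apply: contraction_poly => //; apply: bij_comp; first by exists r; [exact: permKV|exact: permK].
  by apply: bij_comp => //; exists s'; [exact: permKV|exact: permK].
have Pz : Pt (D (young_symmetrizer (T - z))).
  apply: (PH mu smu); first by rewrite sK.
  exists D, (young_symmetrizer (T - z)); split=> //; first exact: ptens_intertwiner.
  exact: weyl_young.
apply: (Pc.2 1 _ _ _ Iz Pz) => p; rewrite /D -dotPr -young_symmetrizerP.
by rewrite scale1r [z + _]addrC subrK.
Qed.

End Span.

(** * Intertwiners and the mean tensor *)

Section Intertwiners.
Variables (R : realType) (m n : nat).
Local Notation G := (grassmannian R m n).
Local Notation orth := (Defs.orthogonal R n).
Implicit Types (p : G) (g : orth).

Lemma orth_inv_subproof g : g^T *m g^T^T = 1%:M.
Proof. by rewrite trmxK orthogonal_trmul. Qed.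

Definition orth_inv g : orth := Orthogonal (orth_inv_subproof g).

Lemma gact_proj g p : orth_proj (Defs.gact g p) = g *m orth_proj p *m g^T.
Proof. exact: orth_proj_rot. Qed.

Lemma grass_inj (p q : G) : orth_proj p = orth_proj q -> p = q.
Proof. by move=> /orth_proj_inj pq; apply: val_inj. Qed.

Lemma gactK g p : Defs.gact g (Defs.gact (orth_inv g) p) = p.
Proof.
apply: grass_inj; rewrite !gact_proj /= trmxK.
have gg : g *m g^T = 1%:M by exact: orth_mxP.
by rewrite !mulmxA gg mul1mx -mulmxA gg mulmx1.
Qed.

Lemma mactK g (B : finType) (T : tens R n B) : mact g (mact (orth_inv g) T) = T.
Proof. by rewrite mactM /= (orth_mxP g) mact1. Qed.

Lemma riesz_weyl_inv (lam : 'I_m -> nat) (l : tens R n (box lam) -> R) w g :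
  weyl_module w -> (forall U, weyl_module U -> l U = dot w U) ->
  (forall U, weyl_module U -> l (mact g U) = l U) -> mact g w = w.
Proof.
move=> Ww lw linv.
have H U : weyl_module U -> dot (mact g w - w) U = 0.
  move=> WU; have WU' : weyl_module (mact (orth_inv g) U) by exact: weyl_mact.
  by rewrite dotBl mact_dot -(lw _ WU') -(linv _ WU') mactK lw // subrr.
apply/eqP; rewrite -subr_eq0; apply/eqP/dot_eq0/H.
exact: (lin_closedB (weyl_lin R n lam) (weyl_mact g Ww) Ww).
Qed.

Lemma grass_base (q : G) : (m <= n)%N -> exists g : orth,
  orth_proj q = g *m block_proj R (@first_coords n m) true *m g^T.
Proof.
move=> mn; have := @orth_proj_base R n q; rewrite (eqP (gspace_dim q)).
by move=> /(_ mn)[g gg E]; exists (Orthogonal gg).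
Qed.

Lemma poly_le_block_prod (J : Type) (l : seq J) (be : J -> bool) (x y : J -> 'I_n) :
  poly_le (size l) (fun p => \prod_(a <- l)
    (if be a then orth_proj p else 1%:M - orth_proj p) (x a) (y a)).
Proof.
elim: l => [|a l IH].
  apply: (fun_closed_ext (poly_le_closed R m n 0) (poly_le_monom R m (leqnn (size [::])))) => p.
  by rewrite /monom !big_nil.
have Pc := poly_le_closed R m n (size l).+1.
have IHP := poly_le_mul (x a) (y a) IH.
case E : (be a).
  apply: (fun_closed_ext Pc IHP) => p; by rewrite big_cons E mulrC.
apply: (Pc.2 (-1) _ _ _ IHP (fun_closedZ (x a == y a)%:R Pc (poly_le_widen IH))) => p.
by rewrite big_cons E !mxE; ring.
Qed.

(* The tensor representing an intertwiner at a base point is invariant under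
   the stabilizer, hence spanned by pairings labelled by [P] and [1 - P]. *)
Lemma intertwiner_poly (lam : 'I_m -> nat) d (Phi : tensor R n lam -> G -> R) T :
  (m <= n)%N -> #|{: box lam}| = d.*2 -> intertwiner Phi -> weyl_module T ->
  poly_le d (Phi T).
Proof.
move=> mn cd [Plin Pact _] WT.
have [[q _]|noG] := pselect (exists q : G, True); last first.
  by exists [::] => // p; case: noG; exists p.
have [g0 g0E] := grass_base q mn.
set P0 := block_proj _ _ _ in g0E.
pose p0 := Defs.gact (orth_inv g0) q.
have p0E : orth_proj p0 = P0.
  rewrite gact_proj g0E /= trmxK !mulmxA orthogonal_trmul mul1mx -mulmxA.
  by rewrite orthogonal_trmul mulmx1.
have base p : exists g, p = Defs.gact g p0.
  have [g gE] := grass_base p mn; exists g; apply: grass_inj.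
  by rewrite gact_proj p0E gE.
have [w Ww wE] := riesz (weyl_lin R n lam) (l := fun U => Phi U p0)
  (fun a x y Wx Wy => Plin a x y p0 Wx Wy).
have stab (g : orth) : compat (@first_coords n m) g -> Defs.gact g p0 = p0.
  move=> cg; apply: grass_inj; rewrite gact_proj p0E compat_block_proj // -mulmxA.
  by rewrite (orth_mxP g) mulmx1.
have winv (g : orth) : compat (@first_coords n m) g -> mact g w = w.
  move=> cg; apply: (riesz_weyl_inv Ww wE) => U WU.
  by rewrite -{1}(stab _ cg); exact: Pact.
have PhiE g : Phi T (Defs.gact g p0) = dot (mact g w) T.
  rewrite mact_dot -wE; last exact: (weyl_mact (orth_inv g)).
  by rewrite -[in LHS](mactK g T); apply: Pact; exact: weyl_mact.
(* Tensors whose matrix coefficients [g |-> dot (mact g a) T'] are polynomials of degree at most [d]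
   in the point [g p0]. Labelled pairings are of this kind, as [g] turns the block projections into
   [P] and [1 - P]. *)
pose A (a : tens R n (box lam)) := forall T', exists2 f, poly_le d f &
  forall g : orth, dot (mact g a) T' = f (Defs.gact g p0).
have Pc := poly_le_closed R m n d.
have Alin : lin_closed A.
  split=> [T'|c x y Ax Ay T'].
    exists (fun=> 0); first exact: Pc.1.
    move=> g; have -> : mact g 0 = 0 :> tens R n (box lam).
      by have := mactB g 0 (0 : tens R n (box lam)); rewrite !subrr.
    by rewrite dot0l.
  have [f1 f1P f1E] := Ax T'; have [f2 f2P f2E] := Ay T'.
  exists (fun p => c * f1 p + f2 p); first exact: (Pc.2 _ _ _ _ f1P f2P).
  by move=> g; rewrite mactP dotP f1E f2E.
have [a Aa aA] := lin_proj Alin w.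
have one_orth : 1%:M *m (1%:M)^T = 1%:M :> 'M[R]_n by rewrite trmx1 mulmx1.
have mact1' : mact (Orthogonal one_orth) a = a by exact: mact1.
(* The matrix coefficients of an element of [A] depend only on [g p0], so the stabilizer of [p0]
   fixes it. *)
have ainv (g : orth) : compat (@first_coords n m) g -> mact g a = a.
  move=> cg; apply/ffunP => i; rewrite -!dot_basis.
  have [f _ fE] := Aa (basis_vec R i).
  rewrite fE (stab _ cg) -mact1' fE stab // => j k jk.
  by rewrite mxE; have [e|//] := eqVneq j k; rewrite e eqxx in jk.
have wa0 : w - a = 0.
  apply: (@invariant_orth_pairings _ _ _ (@first_coords n m)).
    by move=> Q QQ cQ; rewrite mactB (winv (Orthogonal QQ)) // (ainv (Orthogonal QQ)).
  move=> d' h be hb; apply: aA => T'.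
  have dd : d' = d.
    apply: double_inj; rewrite -cd -(bij_eq_card hb) card_prod card_ord card_bool.
    by rewrite muln2.
  pose f (p : G) := dot (ptens h (fun j => if be j then orth_proj p else 1%:M - orth_proj p)) T'.
  exists f => [|g]; last first.
    rewrite mact_ptens // /f; congr (dot (ptens _ _) _); apply/funext => j.
    rewrite gact_proj p0E; case: (be j) => //.
    rewrite block_projC mulmxBr mulmxBl mulmx1.
    by rewrite (orth_mxP g).
  have fE p : f p = \sum_(i : {ffun box lam -> 'I_n}) T' i * \prod_(j <- enum 'I_d')
      (if be j then orth_proj p else 1%:M - orth_proj p) (i (h (j, false))) (i (h (j, true))).
    by apply: eq_bigr => i _; rewrite mulrC ffunE big_enum.
  apply: (fun_closed_ext Pc _ fE); apply: fun_closed_sum => // i.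
  apply: fun_closedZ => //; rewrite -dd -[d' in poly_le d'](size_enum_ord d').
  exact: (poly_le_block_prod (enum 'I_d') be (fun j => i (h (j, false)))).
have {wa0} wA : A w by move/eqP: wa0; rewrite subr_eq0 => /eqP ->.
have [f fP fE] := wA T; apply: (fun_closed_ext Pc fP) => p.
by have [g ->] := base p; rewrite PhiE fE.
Qed.

Section Mean.
Variable t : nat.

(* The point of least norm in the affine hull of the tensors [proj_tens t p];
   the affine hull is encoded by its affine equations. *)
Lemma mean_exists (p0 : G) : exists E : tens R n ('I_t * bool),
  [/\ forall v c, (forall p, dot (proj_tens t p) v = c) -> dot E v = c,
      forall p, dot (proj_tens t p) E = dot E E
    & forall g, mact g E = E].
Proof.
(* The direction space of the affine hull; [E] is [proj_tens t p0] minus its projection to [L]. *)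
pose L (x : tens R n ('I_t * bool)) := forall v c,
  (forall p, dot (proj_tens t p) v = c) -> dot x v = 0.
have Llin : lin_closed L.
  split=> [v c _|a x y Lx Ly v c vc]; first by rewrite dot0l.
  by rewrite dotP (Lx _ _ vc) (Ly _ _ vc) mulr0 addr0.
have [l Ll lL] := lin_proj Llin (proj_tens t p0).
set E := proj_tens t p0 - l in lL.
have HE v c : (forall p, dot (proj_tens t p) v = c) -> dot E v = c.
  by move=> vc; rewrite dotBl vc (Ll _ _ vc) subr0.
have EE p : dot (proj_tens t p) E = dot E E.
  apply/eqP; rewrite -subr_eq0 -dotBl dotC; apply/eqP/lL => v c vc.
  by rewrite dotBl vc (HE _ _ vc) subrr.
clearbody E; exists E; split=> // g; apply/eqP; rewrite -subr_eq0; apply/eqP/dot_eq0.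
(* With equal norms, this equality gives [|gE - E|^2 = 0]. *)
have gE : dot (mact g E) E = dot E E.
  rewrite mact_dot; apply: HE => p.
  by rewrite -mact_dot -proj_tens_act EE.
by rewrite dotBl !dotBr dot_mact_orth gE [dot E (mact g E)]dotC gE !subrr.
Qed.

Variable E : tens R n ('I_t * bool).
Hypothesis HE : forall v c, (forall p, dot (proj_tens t p) v = c) -> dot E v = c.
Hypothesis Einv : forall g, mact g E = E.

Lemma mean_ext v v' : (forall p, dot (proj_tens t p) v = dot (proj_tens t p) v') ->
  dot E v = dot E v'.
Proof.
move=> vv; apply/eqP; rewrite -subr_eq0 -dotBr; apply/eqP/HE => p.
by rewrite dotBr vv subrr.
Qed.

(** The mean of [Phi U] is an invariant functional of [U], represented by an invariant trace-free
    tensor [w]. A pairing contracts two factors of [w], at least one pair being present, so it gives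
    0, and then [w = 0] by the first fundamental theorem. *)
Lemma mean_zero (lam : 'I_m -> nat) (Phi : tensor R n lam -> G -> R) T v :
  (0 < #|{: box lam}|)%N ->
  intertwiner Phi -> (forall U, weyl_module U -> tens_fun t (Phi U)) ->
  weyl_module T -> (forall p, Phi T p = dot (proj_tens t p) v) -> dot E v = 0.
Proof.
move=> c0 [Plin Pact _] PT WT Tv.
have exV (U : tens R n (box lam)) : exists v : tens R n ('I_t * bool),
    weyl_module U -> forall p, Phi U p = dot (proj_tens t p) v.
  by have [/PT[u uE]|] := pselect (weyl_module U); [exists u|exists 0].
(* The choice [V] need not be linear; [mean_ext] shows that [E] does not see the ambiguity. *)
have [V VE] := choice exV.
have Wlin := weyl_lin R n lam.
have [|w Ww wE] := riesz Wlin (l := fun U => dot E (V U)).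
  move=> a x y Wx Wy; rewrite -dotPr; apply: mean_ext => p.
  by rewrite -VE; [rewrite Plin // !VE // dotPr|exact: Wlin.2].
have winv g : mact g w = w.
  apply: (riesz_weyl_inv Ww wE) => U WU.
  rewrite -[in RHS](Einv (orth_inv g)) mact_dot /= trmxK; apply: mean_ext => p.
  rewrite -VE; last exact: weyl_mact.
  rewrite -[p in LHS](gactK g) [LHS]Pact // VE // proj_tens_act mact_dot.
  by rewrite /= trmxK.
suff w0 : w = 0.
  by rewrite -[RHS](dot0l T) -w0 -wE //; apply: mean_ext => p; rewrite -Tv VE.
apply: (@invariant_orth_pairings _ _ _ xpredT) => [Q QQ _|d h be hb].
  exact: (winv (Orthogonal QQ)).
have d0 : (0 < d)%N.
  have := bij_eq_card hb; rewrite card_prod card_ord card_bool => cd.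
  by move: c0; rewrite -cd muln_gt0 => /andP[].
pose j0 : 'I_d := Ordinal d0.
have [h' hK h'K] := hb.
have [Wtr _] := Ww.
(* For the constant colouring a pair labelled [false] contributes 0, whence the first factor. *)
pose phi (i : {ffun box lam -> 'I_n}) : R := (true == be j0)%:R *
  \prod_(j | j != j0) block_proj R xpredT (be j) (i (h (j, false))) (i (h (j, true))).
rewrite -[RHS](@tracefree_sum R n (box lam) w (h (j0, false)) (h (j0, true)) phi) //.
- apply: eq_bigr => i _; rewrite ffunE (bigD1 j0) //= mulrC /phi; congr (_ * _).
  by rewrite mulrA; congr (_ * _); rewrite mxE -natrM mulnb.
- by rewrite (inj_eq (can_inj hK)) xpair_eqE andbF.
move=> i a; rewrite /phi; congr (_ * _); apply: eq_bigr => j jj0.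
by rewrite !ffunE !(inj_eq (can_inj hK)) !xpair_eqE !(negPf jj0).
Qed.

End Mean.

End Intertwiners.

(** * The energy bound and the characterization of designs *)

Lemma card_double_box (m : nat) (mu : m.-tuple nat) :
  #|{: box (fun i => 2 * tnth mu i)%N}| = (sumn mu).*2.
Proof.
have [h [k [hb _ _]]] := @box_matching m (sumn mu) mu erefl.
by rewrite -(bij_eq_card hb) card_prod card_ord card_bool muln2.
Qed.

Lemma poly_le_leq (R : realType) (m n d d' : nat) (f : grassmannian R m n -> R) :
  (d <= d')%N -> poly_le d f -> poly_le d' f.
Proof.
by move=> dd [l sl E]; exists l => //; apply: sub_all sl => z /leq_trans; exact.
Qed.

Local Open Scope fset_scope.

Theorem theorem6 (R : realType) (m n t : nat) :
  (2 * m <= n)%N -> (0 < t)%N ->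
  exists c : R,
    (forall D : {fset grassmannian R m n}, D != fset0 ->
       c <= sigma_energy D t) /\
    (forall D : {fset grassmannian R m n}, D != fset0 ->
       grassmannian_design D t <-> sigma_energy D t = c).
Proof.
move=> m2n t0.
(* For [m = 0] all projections vanish, hence so does the energy as [t > 0], and the empty partition
   has degree 0, so every [D] is a design. *)
have [m0|m0] := posnP m.
  subst m; have E0 (D : {fset grassmannian R 0 n}) : sigma_energy D t = 0.
    rewrite /sigma_energy big1 ?mul0r // => p _; rewrite big1 // => q _.
    rewrite /sigma; have -> : orth_proj p = 0.
      apply/eqP; rewrite -mxrank_eq0 -leqn0.
      by rewrite -[X in (_ <= X)%N](eqP (gspace_dim p)) orth_proj_rank.
    by rewrite mul0mx linear0 expr0n gtn_eqF.
  exists 0; split=> D _; rewrite E0 //; split=> // _ mu _.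
  by rewrite (tuple0 mu).
have mn : (m <= n)%N by apply: leq_trans m2n; rewrite leq_pmull.
have [[p0 _]|noG] := pselect (exists p : grassmannian R m n, True); last first.
  exists 0; split=> D /fset0Pn[p _]; by case: noG; exists p.
have [E [HE EE Einv]] := @mean_exists R m n t p0.
exists (dot E E).
pose N (D : {fset grassmannian R m n}) : R := #|` D|%:R.
pose avg (D : {fset grassmannian R m n}) := (N D)^-1 *: \sum_(p <- D) proj_tens t p.
have N0 D : D != fset0 -> N D != 0 by rewrite pnatr_eq0 cardfs_eq0.
have avgE D v : D != fset0 -> \sum_(p <- D) dot (proj_tens t p) v = N D * dot (avg D) v.
  move=> D0; rewrite dotZl mulrA divff ?N0 // mul1r dotC dot_sumr.
  by apply: eq_bigr => p _; rewrite dotC.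
have sum1 (D : {fset grassmannian R m n}) : \sum_(p <- D) 1 = N D.
  by rewrite big_const_seq count_predT iter_addr_0.
have en D : D != fset0 -> sigma_energy D t = dot (avg D) (avg D).
  move=> D0; rewrite {1}/avg dotZl dotC dot_sumr mulr_sumr /sigma_energy mulr_suml.
  apply: eq_bigr => p _; rewrite dotC.
  under eq_bigr do rewrite -dot_proj_tens.
  rewrite -[in RHS](mulKf (N0 D D0) (dot _ _)) mulrA.
  have -> : N D * dot (proj_tens t p) (avg D) = \sum_(q <- D) dot (proj_tens t p) (proj_tens t q).
    rewrite dotC -avgE //; by apply: eq_bigr => q _; rewrite dotC.
  by rewrite mulrC expr2 invfM.
have avgEE D : D != fset0 -> dot (avg D) E = dot E E.
  move=> D0; apply: (mulfI (N0 _ D0)); rewrite -avgE //.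
  under eq_bigr do rewrite EE -[dot E E]mul1r.
  by rewrite -mulr_suml sum1.
have pyth D : D != fset0 ->
    sigma_energy D t = (dot E E + dot (avg D - E) (avg D - E))%R.
  move=> D0; rewrite en // dotBl !dotBr avgEE // [dot E (avg D)]dotC avgEE //; ring.
split=> D D0; first by rewrite pyth // lerDl dot_ge0.
have iso (mu : m.-tuple nat) f : (1 <= sumn mu <= t)%N ->
    isotypic_component (fun i => 2 * tnth mu i)%N f ->
    exists2 v, forall p, f p = dot (proj_tens t p) v & dot E v = 0.
  move=> /andP[mu1 mut] [Phi [T [Pi WT ->]]].
  have tf U : weyl_module U -> tens_fun t (Phi U).
    move=> WU; apply: poly_le_tens => //; apply: (poly_le_leq mut).
    exact: (intertwiner_poly mn (card_double_box mu) Pi WU).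
  have [v vE] := tf T WT; exists v => //.
  apply: (mean_zero HE Einv _ Pi tf WT vE).
  by rewrite card_double_box double_gt0.
split=> [des|eqE].
  (* The functions represented by a tensor [v] whose average over [D] is the mean [dot E v]. *)
  pose Pt (f : grassmannian R m n -> R) := exists2 v,
    forall p, f p = dot (proj_tens t p) v & \sum_(p <- D) f p = N D * dot E v.
  have Pc : fun_closed Pt.
    split=> [|a f g h [v vE vD] [w wE wD] hE].
      by exists 0; rewrite ?dot0r ?mulr0 ?big1 // => p; rewrite dot0r.
    exists (a *: v + w)%R => [p|]; first by rewrite hE vE wE dotPr.
    under eq_bigr do rewrite hE.
    by rewrite big_split /= -mulr_sumr vD wD dotPr; ring.
  have P1 : Pt (fun=> 1).
    have [v vE] : tens_fun t (fun _ : grassmannian R m n => 1 : R).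
      apply: poly_le_tens => //.
      apply: (fun_closed_ext (poly_le_closed R m n t) (poly_le_monom R m (leq0n t : (size [::] <= t)%N))) => p.
      by rewrite /monom big_nil.
    by exists v => //; rewrite sum1 (HE _ 1) ?mulr1.
  have PH (mu : m.-tuple nat) : sorted geq mu -> (1 <= sumn mu <= t)%N ->
      forall f, isotypic_component (fun i => 2 * tnth mu i)%N f -> Pt f.
    move=> smu mut f Hf; have [v vE Ev] := iso mu f mut Hf.
    by exists v => //; rewrite Ev mulr0; exact: (des mu).
  (* The coordinates of [proj_tens t p] are monomials of degree [t], which belong to [Pt] by
     [poly_span]. *)
  have aE : avg D = E.
    apply/ffunP => i; apply: (mulfI (N0 _ D0)).
    pose s := [seq (i (a, false), i (a, true)) | a <- enum 'I_t].
    have sE p : proj_tens t p i = monom s p.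
      by rewrite ffunE /monom big_map big_enum.
    have [|v vE vD] := @poly_span R m n t Pt mn Pc P1 PH t (monom s) (leqnn t).
      by apply: poly_le_monom; rewrite size_map size_enum_ord.
    rewrite -!dot_basis -avgE //.
    rewrite (_ : dot E _ = dot E v); last first.
      by apply: (mean_ext HE) => p; rewrite dot_basis sE vE.
    by rewrite -vD; apply: eq_bigr => p _; rewrite dot_basis sE.
  by rewrite en // aE.
move=> mu smu mut f Hf; have [v vE Ev] := iso mu f mut Hf.
have aE : avg D = E.
  apply/eqP; rewrite -subr_eq0; apply/eqP/dot_eq0.
  by apply: (addrI (dot E E)); rewrite addr0 -pyth // eqE.
by under eq_bigr do rewrite vE; rewrite avgE // aE Ev mulr0.
Qed.
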